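(* Let $V=P_n(A)\otimes\mathcal H$ be the $H_n^{\mathrm{aff}}(A,z)$-module described in the context. The map $$V=P_n(A)\otimes\mathcal H\to H_n^{\mathrm{aff}}(A,z),\qquad f\otimes T_w\mapsto fT_w\quad (f\in P_n(A),\ w\in S_n),$$ is an isomorphism of $H_n^{\mathrm{aff}}(A,z)$-modules.
   Context: Conventions. $\Bbbk$ is a commutative ring of characteristic not equal to two, $z\in\Bbbk$, and all tensor products are over $\Bbbk$. All algebras and modules are associative superalgebras and supermodules over $\Bbbk$; $\bar a$ is the parity of a homogeneous element $a$; $(a\otimes b)(c\otimes d)=(-1)^{\bar b\bar c}ac\otimes bd$. $A$ is a symmetric superalgebra: there is a parity-preserving linear map $\mathrm{tr}\colon A\to\Bbbk$ ($\Bbbk$ in parity zero) with $\mathrm{tr}(ab)=(-1)^{\bar a\bar b}\mathrm{tr}(ba)$ for homogeneous $a,b$, such that $a\mapsto(b\mapsto\mathrm{tr}(ab))$ is a parity-preserving isomorphism $A\to\mathrm{Hom}_\Bbbk(A,\Bbbk)$. $A$ is free over $\Bbbk$ with a homogeneous (necessarily finite) basis $B$, and dual basis $\{b^\vee\}$ given by $\mathrm{tr}(a^\vee b)=\delta_{a,b}$ for $a,b\in B$. Fix an integer $n\ge1$. For $a\in A$, $a_i=1^{\otimes(i-1)}\otimes a\otimes1^{\otimes(n-i)}\in A^{\otimes n}$; $t_{i,j}=\sum_{b\in B}b_ib_j^\vee$ for $1\le i\ne j\le n$. $S_n$ acts on $A^{\otimes n}$ by superpermutation of factors; $s_i=(i,i+1)$;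 $\ell$ is the length function. $H_n(A,z)$ is the algebra generated by $A^{\otimes n}$ and even elements $T_1,\dots,T_{n-1}$ (free product) modulo: $T_iT_j=T_jT_i$ for $|i-j|>1$; $T_iT_{i+1}T_i=T_{i+1}T_iT_{i+1}$; $T_i^2=zt_{i,i+1}T_i+1$; $T_i\mathbf a=s_i(\mathbf a)T_i$ for $\mathbf a\in A^{\otimes n}$ (so $H_1(A,z)=A$). $H_n^{\mathrm{aff}}(A,z)$ is the free product of $\Bbbk[X_1^{\pm1},\dots,X_n^{\pm1}]$ ($X_i$ even) and $H_n(A,z)$ modulo: $T_iX_j=X_jT_i$ for $j\ne i,i+1$; $T_iX_iT_i=X_{i+1}$; $X_i\mathbf a=\mathbf aX_i$ for $\mathbf a\in A^{\otimes n}$. For $w\in S_n$ with reduced expression $w=s_{i_1}\cdots s_{i_k}$, $T_w=T_{i_1}\cdots T_{i_k}$ (independent of the reduced expression). $P_n=\Bbbk[X_1^{\pm1},\dots,X_n^{\pm1}]$ and $P_n(A)=A^{\otimes n}\otimes P_n$ (tensor product of algebras); an element of $P_n(A)$ also denotes its image under the natural homomorphism $P_n(A)\to H_n^{\mathrm{aff}}(A,z)$. For $w\in S_n$, $f\in P_n(A)$: $w(f)$ is the diagonal action (permuting the $X_i$ and superpermuting the factors of $A^{\otimes n}$), while ${}^wf$ is the $A^{\otimes n}$-linear action permuting only the $X_i$. Demazure operators: $\Delta_i(f)=\dfrac{f-{}^{s_i}f}{1-X_iX_{i+1}^{-1}}$, $1\le i\le n-1$. Module $V$: $\mathcal H$ is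 the free $\Bbbk$-module with basis $\{T_w:w\in S_n\}$ and $V=P_n(A)\otimes\mathcal H$ has the $H_n^{\mathrm{aff}}(A,z)$-action determined, for $f,g\in P_n(A)$, $w\in S_n$, by $f\cdot(g\otimes T_w)=fg\otimes T_w$ and $$T_i\cdot(f\otimes T_w)=\begin{cases}s_i(f)\otimes T_{s_iw}+zt_{i,i+1}\Delta_i(f)\otimes T_w&\text{if }\ell(s_iw)>\ell(w),\\ s_i(f)\otimes T_{s_iw}+zt_{i,i+1}X_{i+1}^{-1}\Delta_i(X_{i+1}f)\otimes T_w&\text{if }\ell(s_iw)<\ell(w).\end{cases}$$ (This does define a module structure.) *)

(* Defs.v *)
From HB Require Import structures.
From mathcomp Require Import all_boot all_order all_fingroup all_algebra.
From mathcomp Require Import generic_quotient finmap boolp classical_sets.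
From mathcomp Require Import monalg zify.

Set Implicit Arguments.
Unset Strict Implicit.
Unset Printing Implicit Defensive.

Import GRing.Theory.
Local Open Scope ring_scope.

(** * Symmetric superalgebras *)

(* [homog S p] is the homogeneous component of parity [p], [true] being odd. *)
Record superalgebra (k : comNzRingType) (A : algType k) := Superalgebra {
  homog :> bool -> A -> Prop;
  homog0 : forall p, homog p 0;
  homog_lin : forall p (c : k) a b,
    homog p a -> homog p b -> homog p (c *: a + b);
  homog_split : forall a, exists a0 a1,
    [/\ homog false a0, homog true a1 & a = a0 + a1];
  homog_direct : forall a, homog false a -> homog true a -> a = 0;
  homog_one : homog false 1;
  homog_mul : forall p q a b,
    homog p a -> homog q b -> homog (p (+) q) (a * b) }.

(* The last two fields say that a |-> (b |-> tr (a b)) is bijective onto the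
   dual module. As [tr] is even, that map and its inverse are then
   parity-preserving. *)
Record trace_form (k : comNzRingType) (A : algType k)
    (S : superalgebra A) := TraceForm {
  tr :> {linear A -> k^o};
  tr_even : forall a, S true a -> tr a = 0;
  tr_sym : forall p q a b, S p a -> S q b ->
    tr (a * b) = (-1) ^+ (p && q) * tr (b * a);
  tr_inj : forall a, (forall b, tr (a * b) = 0) -> a = 0;
  tr_surj : forall phi : {linear A -> k^o},
    exists a, forall b, phi b = tr (a * b) }.

Record homog_basis (k : comNzRingType) (A : algType k) (S : superalgebra A)
    (B : finType) := HomogBasis {
  bvec :> B -> A;
  par : B -> bool;
  bvec_homog : forall b, S (par b) (bvec b);
  bvec_basis : forall a, exists! c : {ffun B -> k},
    a = \sum_b c b *: bvec b }.

Record dual_basis (k : comNzRingType) (A : algType k) (S : superalgebra A)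
    (t : trace_form S) (B : finType) (bs : homog_basis S B) := DualBasis {
  dvec :> B -> A;
  dvecP : forall a b, t (dvec a * bs b) = (a == b)%:R }.

Section Coordinates.
Variables (k : comNzRingType) (A : algType k) (S : superalgebra A).
Variables (B : finType) (bs : homog_basis S B).

Definition bcoord (a : A) : {ffun B -> k} := sval (cid (bvec_basis bs a)).

Lemma bcoord_sum a : a = \sum_b bcoord a b *: bs b.
Proof. by rewrite /bcoord; case: cid => c []. Qed.

Lemma bcoord_uniq a (c : B -> k) :
  a = \sum_b c b *: bs b -> forall b, bcoord a b = c b.
Proof.
move=> ac b; rewrite /bcoord; case: cid => c' /= [_ c'_uniq].
rewrite (c'_uniq (finfun c)) ?ffunE // ac.
by apply: eq_bigr => i _; rewrite ffunE.
Qed.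

Lemma bcoordB b b' : bcoord (bs b) b' = (b == b')%:R.
Proof.
apply: (@bcoord_uniq _ (fun b' => (b == b')%:R)); rewrite (bigD1 b)//= eqxx scale1r.
rewrite big1 ?addr0 // => i /negPf ib.
by rewrite eq_sym ib scale0r.
Qed.

Lemma bcoordP c a a' b : bcoord (c *: a + a') b = c * bcoord a b + bcoord a' b.
Proof.
apply: (@bcoord_uniq _ (fun b => c * bcoord a b + bcoord a' b)).
rewrite {1}(bcoord_sum a) {1}(bcoord_sum a') scaler_sumr -big_split /=.
by apply: eq_bigr => i _; rewrite scalerDl scalerA.
Qed.

Lemma bcoord0 b : bcoord 0 b = 0.
Proof.
by apply: (@bcoord_uniq _ (fun=> 0)); rewrite big1 // => i _; rewrite scale0r.
Qed.

Lemma bcoordZ c a b : bcoord (c *: a) b = c * bcoord a b.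
Proof. by rewrite -[c *: a]addr0 bcoordP bcoord0 addr0. Qed.

Lemma bcoordD a a' b : bcoord (a + a') b = bcoord a b + bcoord a' b.
Proof. by rewrite -[a]scale1r bcoordP mul1r scale1r. Qed.

Lemma bcoord_bigsum (I : finType) (F : I -> A) b :
  bcoord (\sum_i F i) b = \sum_i bcoord (F i) b.
Proof.
by rewrite (big_morph (bcoord^~ b) (fun x y => bcoordD x y b) (bcoord0 b)).
Qed.

Lemma homog_sum p (P : pred B) (c : B -> k) :
  (forall b, P b -> par bs b = p) -> S p (\sum_(b | P b) c b *: bs b).
Proof.
move=> Pp; elim/big_rec: _ => [|b x Pb Sx]; first exact: homog0.
by apply: homog_lin => //; rewrite -(Pp b Pb); apply: bvec_homog.
Qed.

Lemma bcoord_homog p a b : S p a -> par bs b != p -> bcoord a b = 0.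
Proof.
move=> Sa bp; pose F q := \sum_(b | par bs b == q) bcoord a b *: bs b.
have FS q : S q (F q) by apply: homog_sum => i /eqP.
have aF : a = F p + F (~~ p).
  rewrite {1}(bcoord_sum a) (bigID (fun b => par bs b == p)) /=; congr (_ + _).
  by apply: eq_bigl => i; case: (par bs i); case: (p).
have SF : S p (F (~~ p)).
  have -> : F (~~ p) = (-1) *: F p + a by rewrite scaleN1r [X in _ + X]aF addKr.
  exact: homog_lin.
have F0 : F (~~ p) = 0.
  have SF' := FS (~~ p).
  by apply: (@homog_direct _ _ S); move: (SF) (SF'); case: (p).
have : a = \sum_b (if par bs b == p then bcoord a b else 0) *: bs b.
  rewrite {1}aF F0 addr0 /F big_mkcond; apply: eq_bigr => i _.
  by case: ifP; rewrite ?scale0r.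
by move/bcoord_uniq => /(_ b); rewrite (negPf bp).
Qed.

End Coordinates.

(** * The super tensor power of [A] *)

(* The exponent of the sign in
   (a_1 # .. # a_n) (c_1 # .. # c_n) = (-1)^? a_1 c_1 # .. # a_n c_n
   for homogeneous a_i, c_i of parities [p i], [q i] : a_i passes c_j, j < i. *)
Definition tsign n (p q : 'I_n -> bool) : bool :=
  \big[addb/false]_(i < n) \big[addb/false]_(j < n | (j < i)%N) (p i && q j).

(* The exponent of the sign in
   w (a_1 # .. # a_n) = (-1)^? a_(w^-1 1) # .. # a_(w^-1 n). *)
Definition psign n (w : 'S_n) (p : 'I_n -> bool) : bool :=
  \big[addb/false]_(i < n)
    \big[addb/false]_(j < n | (i < j)%N && (w j < w i)%N) (p i && p j).

(* The tensor power of the free module [A], in the basis of the tensors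
   b_1 # .. # b_n of basis vectors: an element is its family of coordinates. *)
Definition tpow (k : comNzRingType) (A : algType k) (S : superalgebra A)
    (B : finType) (bs : homog_basis S B) (n : nat) :=
  {ffun {ffun 'I_n -> B} -> k^o}.

Section TensorPower.
Variables (k : comNzRingType) (A : algType k) (S : superalgebra A).
Variables (B : finType) (bs : homog_basis S B) (n : nat).

Local Notation TA := (tpow bs n).
Implicit Types (x y u : TA) (e f g : {ffun 'I_n -> B}).

HB.instance Definition _ := GRing.Lmodule.copy TA {ffun {ffun 'I_n -> B} -> k^o}.

Definition parf e : 'I_n -> bool := fun i => par bs (e i).

(* a_1 # .. # a_n *)
Definition ptens (a : 'I_n -> A) : TA :=
  [ffun e : {ffun 'I_n -> B} => \prod_i bcoord bs (a i) (e i)].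

Definition tmul x y : TA :=
  \sum_e \sum_f (x e * y f * (-1) ^+ tsign (parf e) (parf f)) *:
    ptens (fun i => bs (e i) * bs (f i)).

Definition tone : TA := ptens (fun=> 1).

Definition tbase e : TA := ptens (fun i => bs (e i)).

Lemma tbaseE e f : tbase e f = (e == f)%:R.
Proof.
rewrite ffunE; under eq_bigr => i _ do rewrite bcoordB.
case: eqVneq => [->|ef]; first by rewrite big1 // => i _; rewrite eqxx.
have /existsP[i /negPf efi] : [exists i, e i != f i].
  by apply: contraR ef => /existsPn ef; apply/eqP/ffunP => i; apply/eqP/negPn.
by rewrite (bigD1 i) //= efi mul0r.
Qed.

Lemma tpow_sum x : x = \sum_e x e *: tbase e.
Proof.
apply/ffunP => f; rewrite sum_ffunE (bigD1 f) //= ffunE tbaseE eqxx.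
rewrite big1 => [|e /negPf ef]; last by rewrite ffunE tbaseE ef; apply: mulr0.
by rewrite addr0; apply/esym/mulr1.
Qed.

Lemma tscaleE (c : k) x e : (c *: x) e = c * x e :> k.
Proof. by rewrite ffunE. Qed.

Lemma tmulDl : left_distributive tmul +%R.
Proof.
move=> x y u; rewrite -big_split; apply: eq_bigr => e _.
rewrite -big_split; apply: eq_bigr => f _.
by rewrite ffunE !mulrDl scalerDl.
Qed.

Lemma tmulDr : right_distributive tmul +%R.
Proof.
move=> x y u; rewrite -big_split; apply: eq_bigr => e _.
rewrite -big_split; apply: eq_bigr => f _.
by rewrite ffunE mulrDr mulrDl scalerDl.
Qed.

Lemma tmulZl c x y : c *: tmul x y = tmul (c *: x) y.
Proof.
rewrite scaler_sumr; apply: eq_bigr => e _; rewrite scaler_sumr.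
by apply: eq_bigr => f _; rewrite scalerA ffunE !mulrA.
Qed.

Lemma tmulZr c x y : c *: tmul x y = tmul x (c *: y).
Proof.
rewrite scaler_sumr; apply: eq_bigr => e _; rewrite scaler_sumr.
by apply: eq_bigr => f _; rewrite scalerA ffunE !mulrA [x e * _]mulrC.
Qed.

Lemma ptens_eq0 (r : 'I_n -> bool) (a : 'I_n -> A) e :
  (forall i, S (r i) (a i)) -> ~ (parf e =1 r) -> ptens a e = 0.
Proof.
move=> ar er; rewrite ffunE.
have /existsP[i ei] : [exists i, parf e i != r i].
  by apply: contra_notT er => /existsPn er i; apply/eqP/negPn.
by rewrite (bigD1 i) //= (bcoord_homog (ar i)) // mul0r.
Qed.

Lemma ptens_mul (p q : 'I_n -> bool) (a c : 'I_n -> A) :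
  (forall i, S (p i) (a i)) -> (forall i, S (q i) (c i)) ->
  tmul (ptens a) (ptens c) = (-1) ^+ tsign p q *: ptens (fun i => a i * c i).
Proof.
move=> ap cq.
have -> : tmul (ptens a) (ptens c) = \sum_e \sum_f (-1) ^+ tsign p q *:
    ((ptens a e * ptens c f) *: ptens (fun i => bs (e i) * bs (f i))).
  apply: eq_bigr => e _; apply: eq_bigr => f _; rewrite scalerA.
  case: (pselect (parf e =1 p)) => [ep|/(ptens_eq0 ap) ->]; last first.
    by rewrite !mul0r mulr0.
  case: (pselect (parf f =1 q)) => [fq|/(ptens_eq0 cq) ->]; last first.
    by rewrite mulr0 mul0r mulr0.
  rewrite mulrC; congr (((-1) ^+ nat_of_bool _ * _) *: _).
  by apply: eq_bigr => i _; apply: eq_bigr => j _; rewrite ep fq.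
under eq_bigr => e _ do rewrite -scaler_sumr.
rewrite -scaler_sumr; congr (_ *: _).
apply/ffunP => h; rewrite sum_ffunE.
under eq_bigr => e _ do rewrite sum_ffunE.
rewrite [RHS]ffunE.
have acE i : bcoord bs (a i * c i) (h i) = \sum_b bcoord bs (a i) b *
    \sum_b' bcoord bs (c i) b' * bcoord bs (bs b * bs b') (h i).
  rewrite {1}(bcoord_sum bs (a i)) mulr_suml bcoord_bigsum.
  apply: eq_bigr => b _; rewrite -scalerAl bcoordZ; congr (_ * _).
  rewrite {1}(bcoord_sum bs (c i)) mulr_sumr bcoord_bigsum.
  by apply: eq_bigr => b' _; rewrite -scalerAr bcoordZ.
under [RHS]eq_bigr => i _ do rewrite acE.
rewrite bigA_distr_bigA /=; apply: eq_bigr => e _.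
rewrite big_split /= bigA_distr_bigA /= mulr_sumr; apply: eq_bigr => f _.
by rewrite tscaleE !ffunE big_split /= -mulrA.
Qed.

Lemma tbase_mul e f : tmul (tbase e) (tbase f) =
  (-1) ^+ tsign (parf e) (parf f) *: ptens (fun i => bs (e i) * bs (f i)).
Proof. by apply: ptens_mul => i; apply: bvec_homog. Qed.

Lemma tsignDl (p p' q : 'I_n -> bool) :
  tsign (fun i => p i (+) p' i) q = tsign p q (+) tsign p' q.
Proof.
rewrite /tsign -big_split; apply: eq_bigr => i _ /=.
rewrite -big_split; apply: eq_bigr => j _ /=.
by case: (p i); case: (p' i); case: (q j).
Qed.

Lemma tsignDr (p q q' : 'I_n -> bool) :
  tsign p (fun i => q i (+) q' i) = tsign p q (+) tsign p q'.
Proof.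
rewrite /tsign -big_split; apply: eq_bigr => i _ /=.
rewrite -big_split; apply: eq_bigr => j _ /=.
by case: (p i); case: (q' j); case: (q j).
Qed.

Lemma bilin_assoc (m : TA -> TA -> TA) :
    left_distributive m +%R -> right_distributive m +%R ->
    (forall c x y, c *: m x y = m (c *: x) y) ->
    (forall c x y, c *: m x y = m x (c *: y)) ->
    (forall e f g, m (tbase e) (m (tbase f) (tbase g)) =
                   m (m (tbase e) (tbase f)) (tbase g)) ->
  associative m.
Proof.
move=> mDl mDr mZl mZr mA.
have m0l x : m 0 x = 0 by rewrite -[0 in LHS](scale0r (0 : TA)) -mZl scale0r.
have m0r x : m x 0 = 0 by rewrite -[0 in LHS](scale0r (0 : TA)) -mZr scale0r.
have m_suml (I : finType) (F : I -> TA) y :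
    m (\sum_i F i) y = \sum_i m (F i) y.
  exact: (big_morph _ (fun a b => mDl a b y) (m0l y)).
have m_sumr (I : finType) (F : I -> TA) y :
    m y (\sum_i F i) = \sum_i m y (F i).
  exact: (big_morph _ (mDr y) (m0r y)).
move=> x y u; rewrite (tpow_sum x) !m_suml; apply: eq_bigr => e _.
rewrite -!(mZl (x e)); congr (_ *: _).
rewrite (tpow_sum y) m_suml !m_sumr m_suml; apply: eq_bigr => f _.
rewrite -(mZl (y f)) -!(mZr (y f)) -(mZl (y f)); congr (_ *: _).
rewrite (tpow_sum u) !m_sumr; apply: eq_bigr => g _.
by rewrite -!(mZr (u g)) mA.
Qed.

Lemma tmulA : associative tmul.
Proof.
apply: (bilin_assoc tmulDl tmulDr tmulZl tmulZr) => e f g.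
rewrite !tbase_mul -tmulZr -tmulZl.
have homM e1 e2 i : S (parf e1 i (+) parf e2 i) (bs (e1 i) * bs (e2 i)).
  by apply: homog_mul; apply: bvec_homog.
rewrite (@ptens_mul (parf e) (fun i => parf f i (+) parf g i)) //; last first.
  by move=> i; apply: bvec_homog.
rewrite (@ptens_mul (fun i => parf e i (+) parf f i) (parf g)) //; last first.
  by move=> i; apply: bvec_homog.
rewrite !scalerA -!signr_addb tsignDl tsignDr.
congr ((-1) ^+ nat_of_bool _ *: _); first by rewrite addbC -addbA.
by apply/ffunP => h; rewrite !ffunE; apply: eq_bigr => i _; rewrite mulrA.
Qed.

Lemma tsign0l (q : 'I_n -> bool) : tsign (fun=> false) q = false.
Proof. by rewrite /tsign big1 // => i _; rewrite big1. Qed.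

Lemma tsign0r (p : 'I_n -> bool) : tsign p (fun=> false) = false.
Proof.
by rewrite /tsign big1 // => i _; rewrite big1 // => j _; rewrite andbF.
Qed.

Lemma tmul1l : left_id tone tmul.
Proof.
have m0 : tmul tone 0 = 0.
  by rewrite -[0 in LHS](scale0r (0 : TA)) -tmulZr scale0r.
move=> x; rewrite (tpow_sum x) (big_morph _ (tmulDr tone) m0).
apply: eq_bigr => e _; rewrite -tmulZr; congr (_ *: _).
rewrite (@ptens_mul (fun=> false) (parf e)) => [|i|i]; last first.
- exact: bvec_homog.
- exact: homog_one.
rewrite tsign0l scale1r; apply/ffunP => f; rewrite !ffunE.
by apply: eq_bigr => i _; rewrite mul1r.
Qed.

Lemma tmul1r : right_id tone tmul.
Proof.
have m0 : tmul 0 tone = 0.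
  by rewrite -[0 in LHS](scale0r (0 : TA)) -tmulZl scale0r.
move=> x; rewrite (tpow_sum x).
rewrite (big_morph _ (fun a b => tmulDl a b tone) m0).
apply: eq_bigr => e _; rewrite -tmulZl; congr (_ *: _).
rewrite (@ptens_mul (parf e) (fun=> false)) => [|i|i]; last first.
- exact: homog_one.
- exact: bvec_homog.
rewrite tsign0r scale1r; apply/ffunP => f; rewrite !ffunE.
by apply: eq_bigr => i _; rewrite mulr1.
Qed.

Lemma tone_neq0 : tone != 0.
Proof.
have [b _] : exists b : B, true.
  apply: contrapT => /forallNP B0; have /eqP := oner_neq0 A.
  by rewrite [LHS](bcoord_sum bs 1) big1 // => b; case: (B0 b).
pose e : {ffun 'I_n -> B} := [ffun=> b].
apply/eqP => t0; have : tbase e = 0.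
  rewrite -[LHS]tmul1l t0.
  by rewrite -[0 in LHS](scale0r (0 : TA)) -tmulZl scale0r.
by move/ffunP => /(_ e) /eqP; rewrite tbaseE eqxx ffunE oner_eq0.
Qed.

HB.instance Definition _ := GRing.Zmodule_isNzRing.Build TA
  tmulA tmul1l tmul1r tmulDl tmulDr tone_neq0.
HB.instance Definition _ := GRing.Lmodule_isLalgebra.Build k TA tmulZl.
HB.instance Definition _ := GRing.Lalgebra_isAlgebra.Build k TA tmulZr.

(* a_i = 1 # .. # a # .. # 1 *)
Definition tinj (i : 'I_n) (a : A) : TA :=
  ptens (fun j => if j == i then a else 1).

Definition superperm (w : 'S_n) x : TA :=
  [ffun e : {ffun 'I_n -> B} =>
    let e' := [ffun i => e (w i)] in (-1) ^+ psign w (parf e') * x e'].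

Lemma superperm_ptens (w : 'S_n) (p : 'I_n -> bool) (a : 'I_n -> A) :
    (forall i, S (p i) (a i)) ->
  superperm w (ptens a) = (-1) ^+ psign w p *: ptens (fun i => a (w^-1%g i)).
Proof.
move=> ap; apply/ffunP => e; rewrite tscaleE [LHS]ffunE /=.
set e' := finfun _.
have -> : ptens (fun i => a (w^-1%g i)) e = ptens a e'.
  rewrite !ffunE (reindex_inj (@perm_inj _ w)); apply: eq_bigr => i _.
  by rewrite permK ffunE.
case: (pselect (parf e' =1 p)) => [ep|/(ptens_eq0 ap) ->]; last first.
  by rewrite !mulr0.
congr ((-1) ^+ nat_of_bool _ * _).
by apply: eq_bigr => i _; apply: eq_bigr => j _; rewrite !ep.
Qed.

Definition thomog (p : bool) x : Prop :=
  forall e, x e != 0 -> \big[addb/false]_i parf e i = p.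

End TensorPower.

Section Teleporter.
Variables (k : comNzRingType) (A : algType k) (S : superalgebra A).
Variables (t : trace_form S) (B : finType) (bs : homog_basis S B).
Variables (bd : dual_basis t bs) (n : nat).

(* t_(i,j) *)
Definition tele (i j : 'I_n) : tpow bs n :=
  \sum_b tinj bs i (bs b) * tinj bs j (bd b).

End Teleporter.

(** * Laurent polynomials *)

(* Laurent polynomials in X_1, .., X_n with coefficients in an algebra [R], i.e.
   the tensor product of [R] with k[X_1^+-1, .., X_n^+-1]; the coefficient at
   [m] is the one of X_1^(m 1) .. X_n^(m n). *)
Definition laurent (k : comNzRingType) (R : algType k) (n : nat) :=
  {malg R[{ffun 'I_n -> int}]}.

Section Laurent.
Variables (k : comNzRingType) (R : algType k) (n : nat).

Local Notation L := (laurent R n).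
Local Notation exponent := {ffun 'I_n -> int}.
Implicit Types (f g h : L) (m : exponent) (c : k).

HB.instance Definition _ := GRing.Zmodule.copy L {malg R[exponent]}.

Definition lmon (a : R) m : L := << a *g m >>.

Definition lscale c f : L := [malg m in msupp f => c *: f@_m].

Definition lmul f g : L :=
  \sum_(m <- msupp f) \sum_(m' <- msupp g) lmon (f@_m * g@_m') (m + m').

Definition lone : L := lmon 1 0.

Lemma lscaleE c f m : (lscale c f)@_m = c *: f@_m.
Proof. by rewrite mcoeffE; case: msuppP; rewrite ?scaler0. Qed.

Fact lscaleA c c' f : lscale c (lscale c' f) = lscale (c * c') f.
Proof. by apply/malgP => m; rewrite !lscaleE scalerA. Qed.

Fact lscale1 : left_id 1 lscale.
Proof. by move=> f; apply/malgP => m; rewrite lscaleE scale1r. Qed.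

Fact lscaleDr : right_distributive lscale +%R.
Proof.
by move=> c f g; apply/malgP => m; rewrite !(lscaleE, mcoeffD) scalerDr.
Qed.

Fact lscaleDl f : {morph lscale^~ f : c c' / c + c'}.
Proof.
by move=> c c'; apply/malgP => m; rewrite !(lscaleE, mcoeffD) scalerDl.
Qed.

HB.instance Definition _ := GRing.Zmodule_isLmodule.Build k L
  lscaleA lscale1 lscaleDr lscaleDl.

Lemma lmonD m : {morph lmon^~ m : a b / a + b}.
Proof. exact: monalgUD. Qed.

Lemma lmon0 m : lmon 0 m = 0.
Proof. exact: monalgU0. Qed.

Lemma lmonZ c a m : c *: lmon a m = lmon (c *: a) m.
Proof.
by apply/malgP => m'; rewrite lscaleE !mcoeffU; case: eqP; rewrite ?scaler0.
Qed.

Lemma laurent_sum f : f = \sum_(m <- msupp f) lmon f@_m m.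
Proof. exact: monalgE. Qed.

Lemma lmulw (d d' : {fset exponent}) f g :
    (msupp f `<=` d)%fset -> (msupp g `<=` d')%fset ->
  lmul f g = \sum_(m <- d) \sum_(m' <- d') lmon (f@_m * g@_m') (m + m').
Proof.
move=> fd gd; rewrite /lmul (big_fset_incl _ fd) /=; last first.
  by move=> m _ /mcoeff_outdom fm; rewrite big1 // => m' _;
     rewrite fm mul0r lmon0.
apply: eq_bigr => m _; apply: big_fset_incl => // m' _ /mcoeff_outdom ->.
by rewrite mulr0 lmon0.
Qed.

Lemma lmulDl : left_distributive lmul +%R.
Proof.
move=> f g h; pose d := (msupp f `|` msupp g)%fset.
rewrite (@lmulw d (msupp h)) ?msuppD_le // (@lmulw d (msupp h) f) ?fsubsetUl //.
rewrite (@lmulw d (msupp h) g) ?fsubsetUr // -big_split.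
apply: eq_bigr => m _; rewrite -big_split; apply: eq_bigr => m' _.
by rewrite mcoeffD mulrDl lmonD.
Qed.

Lemma lmulDr : right_distributive lmul +%R.
Proof.
move=> h f g; pose d := (msupp f `|` msupp g)%fset.
rewrite (@lmulw (msupp h) d) ?msuppD_le // (@lmulw (msupp h) d h f) ?fsubsetUl //.
rewrite (@lmulw (msupp h) d h g) ?fsubsetUr // -big_split.
apply: eq_bigr => m _; rewrite -big_split; apply: eq_bigr => m' _.
by rewrite mcoeffD mulrDr lmonD.
Qed.

Lemma lmul_mon a b m m' : lmul (lmon a m) (lmon b m') = lmon (a * b) (m + m').
Proof.
rewrite (@lmulw [fset m]%fset [fset m']%fset) ?msuppU_le // !big_seq_fset1.
by rewrite !mcoeffUU. Qed.

Lemma lmul0l f : lmul 0 f = 0.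
Proof. by rewrite /lmul msupp0 big_seq_fset0. Qed.

Lemma lmul0r f : lmul f 0 = 0.
Proof. by rewrite /lmul big1 // => m _; rewrite msupp0 big_seq_fset0. Qed.

Lemma laurent_ind (P : L -> Prop) :
    P 0 -> (forall f g, P f -> P g -> P (f + g)) ->
    (forall a m, P (lmon a m)) -> forall f, P f.
Proof.
by move=> P0 PD Pm f; rewrite [f]laurent_sum; elim/big_ind: _.
Qed.

Lemma lmulA : associative lmul.
Proof.
move=> f g h; elim/laurent_ind: f => [|f f' IHf IHf'|a m]; last 1 first.
- elim/laurent_ind: g => [|g g' IHg IHg'|b m']; last 1 first.
  + elim/laurent_ind: h => [|h h' IHh IHh'|c m'']; last 1 first.
    * by rewrite !lmul_mon mulrA addrA.
    * by rewrite !lmul0r.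
    * by rewrite !lmulDr IHh IHh'.
  + by rewrite !(lmul0l, lmul0r).
  + by rewrite !(lmulDl, lmulDr) IHg IHg'.
- by rewrite !lmul0l.
- by rewrite !lmulDl IHf IHf'.
Qed.

Lemma lmul1l : left_id lone lmul.
Proof.
elim/laurent_ind => [|f g IHf IHg|a m]; first exact: lmul0r.
- by rewrite lmulDr IHf IHg.
- by rewrite lmul_mon mul1r add0r.
Qed.

Lemma lmul1r : right_id lone lmul.
Proof.
elim/laurent_ind => [|f g IHf IHg|a m]; first exact: lmul0l.
- by rewrite lmulDl IHf IHg.
- by rewrite lmul_mon mulr1 addr0.
Qed.

Lemma lone_neq0 : lone != 0.
Proof. by rewrite monalgU_eq0 oner_neq0. Qed.

HB.instance Definition _ := GRing.Zmodule_isNzRing.Build L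
  lmulA lmul1l lmul1r lmulDl lmulDr lone_neq0.

Fact lscaleAl c f g : c *: (f * g) = (c *: f) * g.
Proof.
elim/laurent_ind: f => [|f f' IHf IHf'|a m].
- by rewrite scaler0 !mul0r scaler0.
- by rewrite mulrDl !scalerDr mulrDl IHf IHf'.
elim/laurent_ind: g => [|g g' IHg IHg'|b m'].
- by rewrite !mulr0 scaler0.
- by rewrite !mulrDr scalerDr IHg IHg'.
by rewrite lmonZ [_ * _]lmul_mon [RHS]lmul_mon lmonZ scalerAl.
Qed.

Fact lscaleAr c f g : c *: (f * g) = f * (c *: g).
Proof.
elim/laurent_ind: f => [|f f' IHf IHf'|a m].
- by rewrite !mul0r scaler0.
- by rewrite !mulrDl scalerDr IHf IHf'.
elim/laurent_ind: g => [|g g' IHg IHg'|b m'].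
- by rewrite scaler0 !mulr0 scaler0.
- by rewrite mulrDr !scalerDr mulrDr IHg IHg'.
by rewrite lmonZ [_ * _]lmul_mon [RHS]lmul_mon lmonZ scalerAr.
Qed.

HB.instance Definition _ := GRing.Lmodule_isLalgebra.Build k L lscaleAl.
HB.instance Definition _ := GRing.Lalgebra_isAlgebra.Build k L lscaleAr.

Definition xvar (i : 'I_n) : exponent := [ffun j => (j == i)%:Z].

Definition LX i : L := lmon 1 (xvar i).
Definition LXV i : L := lmon 1 (- xvar i).

Lemma LXK i : LX i * LXV i = 1.
Proof. by rewrite [LHS]lmul_mon mulr1 subrr. Qed.

(* [w] maps X_j to X_(w j), and [lperm] fixes the coefficients in [R]. *)
Definition xperm (w : 'S_n) m : exponent := [ffun j => m (w^-1%g j)].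

Definition lperm (w : 'S_n) f : L :=
  \sum_(m <- msupp f) lmon f@_m (xperm w m).

End Laurent.

(** * Simple transpositions, length and reduced words *)

Section SymmetricGroup.
Variable n : nat.

Definition ilo (i : 'I_n.-1) : 'I_n := widen_ord (leq_pred n) i.

Fact ihi_subproof (i : 'I_n.-1) : (i.+1 < n)%N.
Proof. by case: n i => [|n'] []. Qed.

Definition ihi (i : 'I_n.-1) : 'I_n := Ordinal (ihi_subproof i).

Definition sref (i : 'I_n.-1) : 'S_n := tperm (ilo i) (ihi i).

(* [(u * v)%g] is "u, then v", so this is the product s_i w of functions. *)
Definition smul (i : 'I_n.-1) (w : 'S_n) : 'S_n := (w * sref i)%g.

Definition wprod (s : seq 'I_n.-1) : 'S_n := foldr smul 1%g s.

Definition has_word (w : 'S_n) (l : nat) : bool :=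
  [exists s : l.-tuple 'I_n.-1, wprod s == w].

Lemma wprod_cat s s' : wprod (s ++ s') = (wprod s' * wprod s)%g.
Proof. by elim: s => [|i s IH] /=; rewrite ?mulg1 // /smul IH mulgA. Qed.

Lemma wprod_tperm (d : nat) (i j : 'I_n) :
  (i + d = j)%N -> exists s, wprod s = tperm i j.
Proof.
elim: d i j => [|d IH] i j ij.
  by exists [::]; rewrite (_ : i = j) ?tperm1 //; apply: val_inj => /=; lia.
have jn : (j.-1 < n.-1)%N by have := ltn_ord j; lia.
pose l := Ordinal jn; have lj : ihi l = j by apply/val_inj => /=; lia.
have [|s Es] := IH i (ilo l); first by move=> /=; lia.
have [->|il] := eqVneq i (ilo l); first by exists [:: l]; rewrite /= /smul mul1g /sref lj.
exists ([:: l] ++ s ++ [:: l]).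
rewrite !wprod_cat Es /= /smul mul1g -!mulgA.
rewrite -[sref l in X in (X * _)%g]tpermV -conjgE tpermJ tpermL lj tpermD //; first by rewrite eq_sym.
by apply/eqP => /(congr1 val) /=; lia.
Qed.

Lemma wprod_surj (w : 'S_n) : exists s, wprod s = w.
Proof.
have [ts -> _] := prod_tpermP w.
elim: ts => [|[i j] ts [s IH]]; first by exists [::]; rewrite big_nil.
rewrite big_cons /=; have [s' Es'] : exists s, wprod s = tperm i j.
  have [ij|/ltnW ij] := leqP i j; first by apply: (@wprod_tperm (j - i)); lia.
  by rewrite tpermC; apply: (@wprod_tperm (i - j)); lia.
by exists (s ++ s'); rewrite wprod_cat Es' IH.
Qed.

Lemma has_word_ex (w : 'S_n) : exists l, has_word w l.
Proof.
have [s sw] := wprod_surj w; exists (size s).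
by apply/existsP; exists (in_tuple s); rewrite sw.
Qed.

Definition perm_len (w : 'S_n) : nat := ex_minn (has_word_ex w).

Lemma has_word_len (w : 'S_n) : has_word w (perm_len w).
Proof. by rewrite /perm_len; case: ex_minnP. Qed.

Definition reduced_word (w : 'S_n) : seq 'I_n.-1 :=
  xchoose (existsP (has_word_len w)).

Lemma reduced_wordK (w : 'S_n) : wprod (reduced_word w) = w.
Proof. exact/eqP/(xchooseP (existsP (has_word_len w))). Qed.

Lemma size_reduced_word (w : 'S_n) : size (reduced_word w) = perm_len w.
Proof. exact: size_tuple. Qed.

Lemma perm_len_min (s : seq 'I_n.-1) : (perm_len (wprod s) <= size s)%N.
Proof.
rewrite /perm_len; case: ex_minnP => l _; apply.
by apply/existsP; exists (in_tuple s).
Qed.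

End SymmetricGroup.

(** * Demazure operators *)

Section Demazure.
Variables (k : comNzRingType) (R : algType k) (n : nat).
Local Notation L := (laurent R n).
Implicit Types (f g : L) (i : 'I_n.-1).

(* X_i X_(i+1)^-1 *)
Definition xratio i : L := LX R (ilo i) * LXV R (ihi i).

(* The quotient of f - s_i(f) by 1 - X_i X_(i+1)^-1. *)
Definition demazure i f : L :=
  xget 0 [set g : L | (1 - xratio i) * g = f - lperm (sref i) f].

Lemma lpermw (d : {fset {ffun 'I_n -> int}}) (w : 'S_n) f :
  (msupp f `<=` d)%fset ->
  lperm w f = \sum_(m <- d) lmon f@_m (xperm w m).
Proof.
move=> fd; rewrite /lperm (big_fset_incl _ fd) // => m _ /mcoeff_outdom ->.
exact: lmon0.
Qed.

Lemma lpermD (w : 'S_n) : {morph (@lperm _ R n w) : f g / f + g}.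
Proof.
move=> f g; pose d := (msupp f `|` msupp g)%fset.
rewrite (@lpermw d) ?msuppD_le // (@lpermw d w f) ?fsubsetUl //.
rewrite (@lpermw d w g) ?fsubsetUr // -big_split; apply: eq_bigr => m _.
by rewrite mcoeffD lmonD.
Qed.

Lemma lperm_mon (w : 'S_n) (a : R) m :
  lperm w (lmon a m) = lmon a (xperm w m).
Proof.
by rewrite (@lpermw [fset m]%fset) ?msuppU_le // big_seq_fset1 mcoeffUU.
Qed.

Let e i : {ffun 'I_n -> int} := xvar (ilo i) - xvar (ihi i).

Let ilo_ihi i : (ilo i == ihi i) = false.
Proof. by apply/eqP => /(congr1 val) /=; lia. Qed.

Lemma xratioE i : xratio i = lmon 1 (e i).
Proof. by rewrite [LHS]lmul_mon mulr1. Qed.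

Let xperm_sref i m : xperm (sref i) m = m + e i *~ (m (ihi i) - m (ilo i)).
Proof.
apply/ffunP => j; rewrite !ffunE tpermV /e.
have -> c : ((xvar (ilo i) - xvar (ihi i)) *~ c) j =
    c * ((j == ilo i)%:Z - (j == ihi i)%:Z).
  have fE (u : {ffun 'I_n -> int}) : (u *~ c) j = u j * c.
    have nE p : (u *+ p) j = u j * p%:Z.
      elim: p => [|p IH]; first by rewrite mulr0 ffunE.
      by rewrite mulrS ffunE IH -[in RHS]add1n PoszD mulrDr mulr1.
    case: c => p; first by rewrite -pmulrn nE.
    by rewrite NegzE mulrNz ffunE -pmulrn nE mulrN.
  by rewrite fE !ffunE mulrC.
case: tpermP => [->|->|/eqP/negPf -> /eqP/negPf ->].
- by rewrite eqxx ilo_ihi subr0 mulr1 addrC subrK.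
- by rewrite eqxx eq_sym ilo_ihi sub0r mulrN1 opprB addrC subrK.
- by rewrite subrr mulr0 addr0.
Qed.

Let mon_step i (a : R) m :
  (1 - xratio i) * lmon a m = lmon a m - lmon a (m + e i).
Proof. by rewrite mulrBl mul1r xratioE [_ * _]lmul_mon mul1r [e i + _]addrC. Qed.

Let mon_steps i (a : R) m p :
  exists g : L, (1 - xratio i) * g = lmon a m - lmon a (m + e i *+ p).
Proof.
elim: p => [|p [g gE]]; first by exists 0; rewrite mulr0 mulr0n addr0 subrr.
exists (g + lmon a (m + e i *+ p)); rewrite mulrDr gE mon_step.
by rewrite addrA subrK mulrSr [m + (_ + _)]addrA.
Qed.

Lemma demazureP i f : (1 - xratio i) * demazure i f = f - lperm (sref i) f.
Proof.
have [g gP] : exists g : L, (1 - xratio i) * g = f - lperm (sref i) f.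
  elim/(@laurent_ind _ R): f => [|f f' [g gE] [g' gE']|a m].
  - by exists 0; rewrite mulr0 /lperm msupp0 big_seq_fset0 subrr.
  - by exists (g + g'); rewrite mulrDr gE gE' lpermD opprD addrACA.
  rewrite lperm_mon xperm_sref; case: (m (ihi i) - m (ilo i)) => p; first exact: mon_steps.
  have [g gE] := mon_steps i a (m + e i *~ Negz p) p.+1; exists (- g).
  by rewrite mulrN gE opprB NegzE mulrNz -addrA addNr addr0.
exact: (@xgetPex _ 0 [set g : L | (1 - xratio i) * g = f - lperm (sref i) f]
  (ex_intro _ g gP)).
Qed.

Lemma xratio_regular i : GRing.lreg (1 - xratio i).
Proof.
have reg0 g : (1 - xratio i) * g = 0 -> g = 0.
  rewrite mulrBl mul1r => /subr0_eq gY.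
  have Yc h m : (xratio i * h)@_m = h@_(m - e i).
    elim/(@laurent_ind _ R): h => [|h h' IH IH'|a m'].
    - by rewrite mulr0 !mcoeff0.
    - by rewrite mulrDr !mcoeffD IH IH'.
    rewrite xratioE [_ * _]lmul_mon mul1r !mcoeffU.
    by rewrite [in RHS]eq_sym subr_eq [e i + m']addrC eq_sym.
  have gc m p : g@_(m - e i *+ p) = g@_m.
    elim: p => [|p IH]; first by rewrite mulr0n subr0.
    by rewrite mulrSr opprD addrA -Yc -gY IH.
  apply/malgP => m; rewrite mcoeff0; apply/eqP/negPn/negP => gm.
  pose s := [seq m - e i *+ p | p <- iota 0 (size (msupp g)).+1].
  have us : uniq s.
    rewrite map_inj_uniq ?iota_uniq // => p q /addrI/oppr_inj/ffunP/(_ (ilo i)).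
    have nE r : (e i *+ r) (ilo i) = r%:Z.
      have ei : e i (ilo i) = 1 by rewrite !ffunE eqxx ilo_ihi.
      by elim: r => [|r IH]; rewrite ?ffunE // mulrS ffunE IH ei; lia.
    by rewrite !nE => -[].
  have : (size s <= size (msupp g))%N.
    by apply: uniq_leq_size us _ => _ /mapP[p _ ->]; rewrite -mcoeff_neq0 gc.
  by rewrite size_map size_iota ltnn.
by move=> g h gh; apply/subr0_eq/reg0; rewrite mulrBr gh subrr.
Qed.

End Demazure.

(** * Algebras given by generators and relations *)

Local Open Scope quotient_scope.

Section Presentation.
Variables (k : comNzRingType) (G : Type).

Inductive expr :=
| EGen of G
| ECst of k
| EAdd of expr & expr
| EMul of expr & expr.

HB.instance Definition _ := gen_eqMixin expr.
HB.instance Definition _ := gen_choiceMixin expr.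

(* The finest congruence containing [R] for which the expressions form an
   associative unital k-algebra. *)
Inductive econg (R : expr -> expr -> Prop) : expr -> expr -> Prop :=
| econg_rel x y : R x y -> econg R x y
| econg_refl x : econg R x x
| econg_sym x y : econg R x y -> econg R y x
| econg_trans x y u : econg R x y -> econg R y u -> econg R x u
| econg_add x x' y y' : econg R x x' -> econg R y y' ->
    econg R (EAdd x y) (EAdd x' y')
| econg_mul x x' y y' : econg R x x' -> econg R y y' ->
    econg R (EMul x y) (EMul x' y')
| econg_addA x y u : econg R (EAdd x (EAdd y u)) (EAdd (EAdd x y) u)
| econg_addC x y : econg R (EAdd x y) (EAdd y x)
| econg_add0 x : econg R (EAdd (ECst 0) x) x
| econg_addN x : econg R (EAdd (EMul (ECst (-1)) x) x) (ECst 0)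
| econg_mulA x y u : econg R (EMul x (EMul y u)) (EMul (EMul x y) u)
| econg_mul1 x : econg R (EMul (ECst 1) x) x
| econg_mulDl x y u :
    econg R (EMul (EAdd x y) u) (EAdd (EMul x u) (EMul y u))
| econg_mulDr x y u :
    econg R (EMul u (EAdd x y)) (EAdd (EMul u x) (EMul u y))
| econg_cstD c d : econg R (ECst (c + d)) (EAdd (ECst c) (ECst d))
| econg_cstM c d : econg R (ECst (c * d)) (EMul (ECst c) (ECst d))
| econg_cstC c x : econg R (EMul (ECst c) x) (EMul x (ECst c)).

Section Quotient.
Variable R : expr -> expr -> Prop.

Definition econgb : rel expr := fun x y => `[< econg R x y >].

Fact econgb_equiv : equiv_class_of econgb.
Proof.
split=> [x|x y|y x u]; first by apply/asboolP; apply: econg_refl.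
- by apply/asboolP/asboolP => /econg_sym.
- by move=> /asboolP xy /asboolP yu; apply/asboolP; apply: econg_trans yu.
Qed.

Canonical econgb_rel := EquivRelPack econgb_equiv.

Definition presented := {eq_quot econgb_rel}.

HB.instance Definition _ := Choice.on presented.
HB.instance Definition _ := EqQuotient.on presented.

Definition pclass (x : expr) : presented := \pi_presented x.

Lemma pclassP x y : reflect (econg R x y) (pclass x == pclass y).
Proof. by rewrite eqmodE; apply: asboolP. Qed.

Lemma pclassW (P : presented -> Prop) : (forall x, P (pclass x)) -> forall u, P u.
Proof. by move=> Px u; rewrite -[u]reprK; apply: Px. Qed.

Lemma pclass_repr x : econg R (repr (pclass x)) x.
Proof. by apply/pclassP; rewrite /pclass reprK. Qed.

Definition padd (u v : presented) : presented := pclass (EAdd (repr u) (repr v)).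
Definition pmul (u v : presented) : presented := pclass (EMul (repr u) (repr v)).
Definition popp (u : presented) : presented := pclass (EMul (ECst (-1)) (repr u)).
Definition pscale (c : k) (u : presented) : presented :=
  pclass (EMul (ECst c) (repr u)).

Lemma pclassD x y : padd (pclass x) (pclass y) = pclass (EAdd x y).
Proof. by apply/eqP/pclassP; apply: econg_add; apply: pclass_repr. Qed.

Lemma pclassM x y : pmul (pclass x) (pclass y) = pclass (EMul x y).
Proof. by apply/eqP/pclassP; apply: econg_mul; apply: pclass_repr. Qed.

Lemma pclassZ c x : pscale c (pclass x) = pclass (EMul (ECst c) x).
Proof.
by apply/eqP/pclassP; apply: econg_mul; [apply: econg_refl|apply: pclass_repr].
Qed.

Lemma pclassN x : popp (pclass x) = pclass (EMul (ECst (-1)) x).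
Proof. exact: pclassZ. Qed.

Let pE := (pclassD, pclassM, pclassZ, pclassN).

Fact paddA : associative padd.
Proof.
do 3!elim/pclassW => ?; rewrite !pE; apply/eqP/pclassP; exact: econg_addA.
Qed.

Fact paddC : commutative padd.
Proof. do 2!elim/pclassW => ?; rewrite !pE; apply/eqP/pclassP; exact: econg_addC. Qed.

Fact padd0 : left_id (pclass (ECst 0)) padd.
Proof. elim/pclassW => ?; rewrite !pE; apply/eqP/pclassP; exact: econg_add0. Qed.

Fact paddN : left_inverse (pclass (ECst 0)) popp padd.
Proof. elim/pclassW => ?; rewrite !pE; apply/eqP/pclassP; exact: econg_addN. Qed.

HB.instance Definition _ := GRing.isZmodule.Build presented paddA paddC padd0 paddN.

Fact pmulA : associative pmul.
Proof.
do 3!elim/pclassW => ?; rewrite !pE; apply/eqP/pclassP; exact: econg_mulA.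
Qed.

Fact pmul1l : left_id (pclass (ECst 1)) pmul.
Proof. elim/pclassW => ?; rewrite !pE; apply/eqP/pclassP; exact: econg_mul1. Qed.

Fact pmul1r : right_id (pclass (ECst 1)) pmul.
Proof.
elim/pclassW => x; rewrite !pE; apply/eqP/pclassP.
by apply: (econg_trans (econg_sym (econg_cstC _ _ _))); apply: econg_mul1.
Qed.

Fact pmulDl : left_distributive pmul padd.
Proof.
do 3!elim/pclassW => ?; rewrite !pE; apply/eqP/pclassP; exact: econg_mulDl.
Qed.

Fact pmulDr : right_distributive pmul padd.
Proof.
do 3!elim/pclassW => ?; rewrite !pE; apply/eqP/pclassP; exact: econg_mulDr.
Qed.

HB.instance Definition _ := GRing.Zmodule_isPzRing.Build presented
  pmulA pmul1l pmul1r pmulDl pmulDr.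

Fact pscaleA c d u : pscale c (pscale d u) = pscale (c * d) u.
Proof.
elim/pclassW: u => x; rewrite !pE; apply/eqP/pclassP.
apply: (econg_trans (econg_mulA _ _ _ _)); apply: econg_mul (econg_refl _ _).
exact/econg_sym/econg_cstM.
Qed.

Fact pscale1 : left_id 1 pscale.
Proof. elim/pclassW => ?; rewrite !pE; apply/eqP/pclassP; exact: econg_mul1. Qed.

Fact pscaleDr : right_distributive pscale +%R.
Proof.
move=> c; elim/pclassW => x; elim/pclassW => y.
have -> : pclass x + pclass y = pclass (EAdd x y) by apply: pclassD.
rewrite !pE [RHS]pclassD; apply/eqP/pclassP; exact: econg_mulDr.
Qed.

Fact pscaleDl u : {morph pscale^~ u : c d / c + d}.
Proof.
move=> c d; elim/pclassW: u => x; rewrite !pE; apply/esym.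
rewrite [LHS]pclassD; apply/eqP/pclassP; apply/econg_sym.
apply: econg_trans (econg_mulDl _ _ _ _).
by apply: econg_mul (econg_refl _ _); apply: econg_cstD.
Qed.

HB.instance Definition _ := GRing.Zmodule_isLmodule.Build k presented
  pscaleA pscale1 pscaleDr pscaleDl.

Lemma pscalerAl c (u v : presented) : c *: (u * v) = (c *: u) * v.
Proof.
elim/pclassW: u => x; elim/pclassW: v => y.
have -> : pclass x * pclass y = pclass (EMul x y) by apply: pclassM.
rewrite /GRing.scale /GRing.mul /= !pE; apply/eqP/pclassP; exact: econg_mulA.
Qed.

Lemma pscalerAr c (u v : presented) : c *: (u * v) = u * (c *: v).
Proof.
elim/pclassW: u => x; elim/pclassW: v => y.
have -> : pclass x * pclass y = pclass (EMul x y) by apply: pclassM.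
rewrite /GRing.scale /GRing.mul /= !pE; apply/eqP/pclassP.
apply: (econg_trans (econg_mulA _ _ _ _)).
apply: econg_trans (econg_sym (econg_mulA _ _ _ _)).
by apply: econg_mul (econg_refl _ _); apply: econg_cstC.
Qed.

Definition pgen (g : G) : presented := pclass (EGen g).

End Quotient.

(* The grading for which a generator [g] such that [hg p g] has parity [p]. *)
Inductive ehomog (hg : bool -> G -> Prop) : bool -> expr -> Prop :=
| ehomog_gen p g : hg p g -> ehomog hg p (EGen g)
| ehomog_cst c : ehomog hg false (ECst c)
| ehomog_zero p : ehomog hg p (ECst 0)
| ehomog_add p x y : ehomog hg p x -> ehomog hg p y -> ehomog hg p (EAdd x y)
| ehomog_mul p q x y : ehomog hg p x -> ehomog hg q y ->
    ehomog hg (p (+) q) (EMul x y).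

Definition phomog R (hg : bool -> G -> Prop) (p : bool) (u : presented R) :=
  exists2 x, ehomog hg p x & pclass R x = u.

(* The relations making [inc], with values in the generators, a morphism of
   algebras. *)
Inductive morphism_rel (C : pzRingType) (cst : k -> C) (inc : C -> G) :
    expr -> expr -> Prop :=
| morphism_add a b : morphism_rel cst inc (EGen (inc (a + b)))
    (EAdd (EGen (inc a)) (EGen (inc b)))
| morphism_mul a b : morphism_rel cst inc (EGen (inc (a * b)))
    (EMul (EGen (inc a)) (EGen (inc b)))
| morphism_cst c : morphism_rel cst inc (EGen (inc (cst c))) (ECst c).

End Presentation.

(** * The algebras H_n(A, z) and H_n^aff(A, z) *)

Section HeckeAlgebras.
Variables (k : comNzRingType) (A : algType k) (S : superalgebra A).
Variables (t : trace_form S) (B : finType) (bs : homog_basis S B).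
Variables (bd : dual_basis t bs) (n : nat) (z : k).

Local Notation TA := (tpow bs n).
Local Notation Pn := (laurent k^o n).
Local Notation PnA := (laurent TA n).
Local Notation "x |+| y" := (EAdd x y) (at level 50, left associativity).
Local Notation "x |*| y" := (EMul x y) (at level 40, left associativity).

Definition Hn_gen : Type := TA + 'I_n.-1.

Local Notation a_ a := (EGen k (inl a : Hn_gen)).
Local Notation T_ i := (EGen k (inr i : Hn_gen)).

Inductive Hn_rel : expr k Hn_gen -> expr k Hn_gen -> Prop :=
| Hn_tpow x y : morphism_rel (fun c => c%:A) (inl : TA -> Hn_gen) x y -> Hn_rel x y
| Hn_comm (i j : 'I_n.-1) : (i.+1 < j)%N || (j.+1 < i)%N -> Hn_rel (T_ i |*| T_ j) (T_ j |*| T_ i)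
| Hn_braid (i j : 'I_n.-1) : j = i.+1 :> nat ->
    Hn_rel (T_ i |*| T_ j |*| T_ i) (T_ j |*| T_ i |*| T_ j)
| Hn_quad i : Hn_rel (T_ i |*| T_ i)
    (a_ (z *: tele bd (ilo i) (ihi i)) |*| T_ i |+| ECst Hn_gen 1)
| Hn_perm i a : Hn_rel (T_ i |*| a_ a) (a_ (superperm (sref i) a) |*| T_ i).

Definition Hn := presented Hn_rel.

Definition Hn_T (i : 'I_n.-1) : Hn := pgen Hn_rel (inr i).
Definition Hn_A (a : TA) : Hn := pgen Hn_rel (inl a).

Definition Hn_homog : bool -> Hn -> Prop :=
  phomog (fun p g => match g with inl a => thomog p a | inr _ => p = false end).

Definition Haff_gen : Type := Pn + Hn.

Local Notation f_ f := (EGen k (inl f : Haff_gen)).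
Local Notation h_ h := (EGen k (inr h : Haff_gen)).
Local Notation X_ j := (f_ (LX k^o j)).

Inductive Haff_rel : expr k Haff_gen -> expr k Haff_gen -> Prop :=
| Haff_Pn x y :
    morphism_rel (fun c => c%:A) (inl : Pn -> Haff_gen) x y -> Haff_rel x y
| Haff_Hn x y :
    morphism_rel (C := Hn) (fun c => c *: (1 : Hn)) (inr : Hn -> Haff_gen) x y -> Haff_rel x y
| Haff_TX i j : j != ilo i -> j != ihi i ->
    Haff_rel (h_ (Hn_T i) |*| X_ j) (X_ j |*| h_ (Hn_T i))
| Haff_TXT i :
    Haff_rel (h_ (Hn_T i) |*| X_ (ilo i) |*| h_ (Hn_T i)) (X_ (ihi i))
| Haff_XA j a : Haff_rel (X_ j |*| h_ (Hn_A a)) (h_ (Hn_A a) |*| X_ j).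

Definition Haff := presented Haff_rel.

Definition Haff_T (i : 'I_n.-1) : Haff := pgen Haff_rel (inr (Hn_T i)).
Definition Haff_Tw (w : 'S_n) : Haff := \prod_(i <- reduced_word w) Haff_T i.

(* The natural homomorphism P_n(A) -> H_n^aff(A, z). *)
Definition Haff_P (f : PnA) : Haff :=
  \sum_(m <- msupp f)
    pgen Haff_rel (inr (Hn_A f@_m)) * pgen Haff_rel (inl (lmon 1 m)).

Definition Haff_homog : bool -> Haff -> Prop :=
  phomog (fun p g => match g with inl _ => p = false | inr h => Hn_homog p h end).

(** * The module V *)

(* w(f), permuting both the X_j and the factors of A^(tensor n) *)
Definition diag_perm (w : 'S_n) (f : PnA) : PnA :=
  \sum_(m <- msupp f) lmon (superperm w f@_m) (xperm w m).

(* The constant [a] of P_n(A) *)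
Definition lcst (a : TA) : PnA := lmon a 0.

(* P_n(A) # H, where H is free on the T_w: the value at [w] is the coefficient of
   T_w. *)
Definition Vmod := {ffun 'S_n -> PnA}.
HB.instance Definition _ := GRing.Lmodule.copy Vmod {ffun 'S_n -> PnA}.

(* f # T_w *)
Definition vtens (f : PnA) (w : 'S_n) : Vmod :=
  [ffun w' => if w' == w then f else 0].

Definition Vhomog (p : bool) (v : Vmod) : Prop :=
  forall w m, thomog p (v w)@_m.

(* f # T_w |-> f T_w *)
Definition V_to_Haff (v : Vmod) : Haff := \sum_w Haff_P (v w) * Haff_Tw w.

Lemma V_to_HaffE f w : V_to_Haff (vtens f w) = Haff_P f * Haff_Tw w.
Proof.
rewrite /V_to_Haff (bigD1 w) //= big1 => [|w' /negPf ww'].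
  by rewrite addr0 ffunE eqxx.
by rewrite ffunE ww' /Haff_P msupp0 big_seq_fset0 mul0r.
Qed.

End HeckeAlgebras.

(** * Modules *)

Record left_module (H : pzRingType) (V : zmodType) := LeftModule {
  mact :> H -> V -> V;
  mactA : forall h h' v, mact h (mact h' v) = mact (h * h') v;
  mact1 : forall v, mact 1 v = v;
  mactDr : forall h, {morph mact h : u v / u + v};
  mactDl : forall v, {morph mact^~ v : h h' / h + h'} }.

Definition regular_module (H : pzRingType) : left_module H H :=
  @LeftModule H H *%R (@mulrA H) (@mul1r H) (@mulrDr H)
    (fun v h h' => mulrDl h h' v).

Definition module_iso (H : pzRingType) (V W : zmodType) (M : left_module H V)
    (N : left_module H W) (phi : V -> W) : Prop :=
  [/\ {morph phi : u v / u + v}, forall h v, phi (M h v) = N h (phi v)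
    & bijective phi].

(* Main.v *)
Require Import Defs.
From HB Require Import structures.
From mathcomp Require Import all_boot all_order all_fingroup all_algebra.
From mathcomp Require Import finmap monalg zify.

(* Injectivity: acting on 1 # T_1, the element f T_w gives back f # T_w, as the
   second terms of the T_i-action vanish on constants. Surjectivity: once the map
   is known to be H-linear, h is the image of h . (1 # T_1).

   H-linearity amounts to the relation
     T_i f = s_i(f) T_i + z t_(i,i+1) Delta_i(f)
   in H_n^aff(A, z), to T_i T_w = T_(s_i w) when the length goes up (Matsumoto's
   theorem, proved by counting inversions), and, when it goes down, to
     X_(i+1)^-1 Delta_i(X_(i+1) f) = (f with X_i, X_(i+1) swapped) + Delta_i(f). *)

Set Implicit Arguments.
Unset Strict Implicit.
Unset Printing Implicit Defensive.

Import GRing.Theory.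
Local Open Scope ring_scope.

(** The super signs and the teleporter, which does not commute with A^(tensor n), shape the proof of
    the relation for [T_i f]. On monomials in the X_j with coefficient 1 the diagonal and the X-only
    actions agree and z t_(i,i+1) is central enough for the relation to pass to products and
    inverses, so it is proved there. A coefficient [a] is put in afterwards through T_i a = s_i(a)
    T_i and s_i(a) z t_(i,i+1) = z t_(i,i+1) a, the latter obtained inside H_n^aff(A, z) rather than
    from sign computations. The same identity is the origin of the X-only swap in the last formula.
    When the length goes down, T_i T_w = z t_(i,i+1) T_w + T_(s_i w), so s_i(f) meets the
    teleporter; moving the teleporter to its left undoes the permutation of the tensor factors and
    leaves only X_i and X_(i+1) swapped. *)

(** * Length, descents and reduced words in S_n *)

Section Length.
Variable n : nat.
Implicit Types (w : 'S_n) (i j : 'I_n.-1) (s : seq 'I_n.-1).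

(** Left descents, read on the values of [w^-1]; [perm_len_up] and [perm_len_down] link them to the
    length. *)
Definition descent i w : bool := (w^-1 (ihi i) < w^-1 (ilo i))%g%N.

Lemma ilo_neq_ihi i : ilo i != ihi i.
Proof. by apply/eqP => /(congr1 val) /=; lia. Qed.

Lemma smulK i : involutive (@smul n i).
Proof. by move=> w; rewrite /smul -mulgA tperm2 mulg1. Qed.

Lemma smulV i w p : (smul i w)^-1%g p = w^-1%g (sref i p).
Proof. by rewrite invMg permM tpermV. Qed.

Lemma descent_smul i w : descent i (smul i w) = ~~ descent i w.
Proof.
rewrite /descent !smulV tpermL tpermR -leqNgt [RHS]leq_eqVlt.
by rewrite (inj_eq (@ord_inj n)) (inj_eq perm_inj) (negPf (ilo_neq_ihi i)).
Qed.

(** Counted on [w^-1], so that multiplying [w] by s_i on the left acts on the pairs of positions. *)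
Definition inversions w : nat :=
  \sum_(pq : 'I_n * 'I_n) ((pq.1 < pq.2) && (w^-1 pq.2 < w^-1 pq.1))%g%N.

(** After reindexing the pairs by s_i, the conditions on [w^-1] agree on both sides and only [p < q]
    becomes [s_i p < s_i q]. These differ just for the pairs (i, i+1) and (i+1, i), which are split
    off. *)
Lemma inversions_up i w :
  ~~ descent i w -> inversions (smul i w) = (inversions w).+1.
Proof.
move=> wi; pose h (pq : 'I_n * 'I_n) := (sref i pq.1, sref i pq.2).
have hK : involutive h by case=> p q; rewrite /h /= !tpermK.
rewrite /inversions (reindex_inj (inv_inj hK)) /=.
under eq_bigr => pq _ do rewrite !smulV !tpermK.
have lohi := ilo_neq_ihi i.
have D : (ihi i, ilo i) != (ilo i, ihi i) by rewrite xpair_eqE negb_and lohi orbT.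
rewrite (bigD1 (ilo i, ihi i)) // (bigD1 (ihi i, ilo i)) //=.
rewrite [in RHS](bigD1 (ilo i, ihi i)) // [in RHS](bigD1 (ihi i, ilo i)) //=.
rewrite !tpermL !tpermR /=.
have wlt : (w^-1 (ilo i) < w^-1 (ihi i))%g%N.
  by move: wi; rewrite -descent_smul /descent !smulV tpermL tpermR.
have -> : (i.+1 < i)%N = false by lia.
have -> : (i < i.+1)%N by lia.
rewrite wlt ltnNge (ltnW wlt) /= !add0n add1n; congr _.+1.
apply: eq_bigr => -[p q] /=; rewrite !xpair_eqE => H; congr (nat_of_bool (_ && _)).
have neq (a b : 'I_n) : (a == b) = (a == b :> nat) by [].
move: H; rewrite /sref; case: tpermP => [->|->|/eqP + /eqP];
  case: tpermP => [->|->|/eqP + /eqP];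
  rewrite ?neq /=; lia.
Qed.

Lemma inversions_down i w :
  descent i w -> inversions w = (inversions (smul i w)).+1.
Proof. by move=> wi; rewrite -(@inversions_up i) ?smulK // descent_smul negbK. Qed.

(** Without descents [w^-1] is strictly increasing, hence [p <= w^-1 p] by induction from the bottom
    and [w^-1 p <= p] by induction from the top. *)
Lemma descent_ex w : w != 1%g -> exists i, descent i w.
Proof.
move=> w1; apply/existsP; apply: contraR w1 => /existsPn wi; apply/eqP.
have vlt i : (w^-1 (ilo i) < w^-1 (ihi i))%g%N.
  have := wi i; rewrite -leqNgt leq_eqVlt (inj_eq (@ord_inj n)) (inj_eq perm_inj).
  by rewrite (negPf (ilo_neq_ihi i)).
have vS (p q : 'I_n) : q = p.+1 :> nat -> (w^-1 p < w^-1 q)%g%N.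
  move=> qp; have pn : (p < n.-1)%N by have := ltn_ord q; lia.
  have lp : ilo (Ordinal pn) = p by apply: ord_inj.
  have hq : ihi (Ordinal pn) = q by apply: ord_inj.
  by have := vlt (Ordinal pn); rewrite lp hq.
have ge m (p : 'I_n) : p = m :> nat -> (p <= w^-1 p)%g%N.
  elim: m p => [|m IH] p pm; first by rewrite pm.
  have mn : (m < n)%N by have := ltn_ord p; lia.
  by have := IH (Ordinal mn) erefl; have := vS (Ordinal mn) p pm; rewrite pm /=; lia.
have le m (p : 'I_n) : (p + m).+1 = n -> (w^-1 p <= p)%g%N.
  elim: m p => [|m IH] p pm; first by have := ltn_ord (w^-1 p)%g; lia.
  have pn : (p.+1 < n)%N by lia.
  by have := IH (Ordinal pn); have := vS p (Ordinal pn) erefl; rewrite /= ; lia.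
apply: invg_inj; rewrite invg1; apply/permP => p; rewrite perm1; apply/val_inj/eqP.
rewrite eqn_leq (ge p) ?(le (n - p.+1)%N) //.
by have := ltn_ord p; lia.
Qed.

Lemma perm_len_smul_le i w : (perm_len (smul i w) <= (perm_len w).+1)%N.
Proof.
have := perm_len_min (i :: reduced_word w).
by rewrite /= reduced_wordK size_reduced_word.
Qed.

Lemma perm_len1 : perm_len (1%g : 'S_n) = 0%N.
Proof. by apply/eqP; rewrite -leqn0; apply: (perm_len_min [::]). Qed.

Lemma inversions1 : inversions 1 = 0%N.
Proof.
apply: big1 => -[p q] _; rewrite invg1 !perm1 /=.
by case: ltngtP.
Qed.

(** Removing descents one at a time writes [w] with [inversions w] letters; conversely each letter
    of a word adds at most one inversion. *)
Lemma perm_lenE w : perm_len w = inversions w.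
Proof.
apply/eqP; rewrite eqn_leq; apply/andP; split.
  move: {-1}(inversions w) (leqnn (inversions w)) => m.
  elim: m w => [|m IH] w wm;
    have [->|/descent_ex[i wi]] := eqVneq w 1%g; rewrite ?perm_len1 //.
    by rewrite (inversions_down wi) in wm.
  rewrite (inversions_down wi) in wm.
  by rewrite -{1}(smulK i w); apply: leq_trans (perm_len_smul_le _ _) _; apply: IH.
rewrite -size_reduced_word -{1}(reduced_wordK w).
elim: (reduced_word w) => [|i s IH] /=; first by rewrite inversions1.
have [/inversions_down E|/inversions_up ->] := boolP (descent i (wprod s)) => //.
by rewrite E in IH; lia.
Qed.

Lemma perm_len_up i w : ~~ descent i w -> perm_len (smul i w) = (perm_len w).+1.
Proof. by rewrite !perm_lenE; apply: inversions_up. Qed.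

Lemma perm_len_down i w : descent i w -> perm_len w = (perm_len (smul i w)).+1.
Proof. by rewrite !perm_lenE; apply: inversions_down. Qed.

Definition reduced s : bool := perm_len (wprod s) == size s.

Lemma reduced_word_reduced w : reduced (reduced_word w).
Proof. by rewrite /reduced reduced_wordK size_reduced_word. Qed.

Lemma reduced_cons i s : reduced (i :: s) = ~~ descent i (wprod s) && reduced s.
Proof.
rewrite /reduced /=; have := perm_len_min s.
have [/perm_len_down|/perm_len_up ->] := boolP (descent i (wprod s));
  rewrite ?eqSS //.
by move=> /= ?; lia.
Qed.

Lemma sref_comm i j : (i.+1 < j)%N || (j.+1 < i)%N ->
  [/\ sref i (ilo j) = ilo j, sref i (ihi j) = ihi j
    & (sref i * sref j = sref j * sref i)%g].
Proof.
move=> ij.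
have H (i' j' : 'I_n.-1) : (i'.+1 < j')%N || (j'.+1 < i')%N ->
    sref i' (ilo j') = ilo j' /\ sref i' (ihi j') = ihi j'.
  by move=> ?; rewrite !tpermD // -val_eqE /=; lia.
have [-> ->] := H _ _ ij; split=> //.
have [E1 E2] := H j i ltac:(lia).
apply/(mulgI (sref j)^-1%g); rewrite mulKg -/(conjg _ _) tpermJ.
by rewrite E1 E2.
Qed.

Section Matsumoto.
Variables (R : pzRingType) (T : 'I_n.-1 -> R).
Hypothesis T_comm : forall i j,
  (i.+1 < j)%N || (j.+1 < i)%N -> T i * T j = T j * T i.
Hypothesis T_braid : forall i j,
  j = i.+1 :> nat -> T i * T j * T i = T j * T i * T j.

(* Matsumoto's theorem, by induction on the length: if the reduced words start with
   [i != j], then both are descents, so that [w] also has reduced words starting with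
   [i j] and [j i], or with [i j i] and [j i j]. *)
Lemma reduced_prod s s' : reduced s -> reduced s' -> wprod s = wprod s' ->
  \prod_(i <- s) T i = \prod_(i <- s') T i.
Proof.
have [m] := ubnP (size s); elim: m s s' => // m IH.
have step i j u v : (i < j)%N -> (size u < m)%N ->
    reduced (i :: u) -> reduced (j :: v) -> wprod (i :: u) = wprod (j :: v) ->
    \prod_(l <- i :: u) T l = \prod_(l <- j :: v) T l.
  move=> ij um; rewrite !reduced_cons !big_cons /= => /andP[iu ru] /andP[jv rv] uv.
  set w := smul i (wprod u) in uv.
  have uE : wprod u = smul i w by rewrite /w smulK.
  have vE : wprod v = smul j w by rewrite uv smulK.
  have vm : (size v < m)%N.
    have := congr1 (@perm_len n) uv; rewrite !perm_len_up //.
    by rewrite (eqP ru) (eqP rv) => -[<-].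
  have wi : descent i w by rewrite /w descent_smul.
  have wj : descent j w by rewrite uv descent_smul.
  clearbody w.
  have [ij1|ij1] := eqVneq (j : nat) i.+1.
    have loj : ilo j = ihi i by apply: val_inj.
    have ab := ilo_neq_ihi i; have bc := ilo_neq_ihi j; rewrite loj in bc.
    have ac : ilo i != ihi j by rewrite -val_eqE /= ij1; lia.
    have sia : sref i (ilo i) = ihi i by apply: tpermL.
    have sib : sref i (ihi i) = ilo i by apply: tpermR.
    have sic : sref i (ihi j) = ihi j by apply: tpermD.
    have sja : sref j (ilo i) = ilo i by rewrite /sref loj tpermD // eq_sym.
    have sjb : sref j (ihi i) = ihi j by rewrite /sref loj tpermL.
    have sjc : sref j (ihi j) = ihi i by rewrite /sref loj tpermR.
    (* Two adjacent descents say that [w^-1] is decreasing on the three places i, i+1, i+2, so that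
       s_i s_j s_i removes three inversions. *)
    move: wi wj; rewrite /descent loj => wi wj.
    pose r := reduced_word (smul i (smul j (smul i w))).
    (* Both triple products are conjugates of a simple transposition, equal to the transposition of
       i and i+2. *)
    have braid : smul i (smul j (smul i w)) = smul j (smul i (smul j w)).
      rewrite /smul -!mulgA; congr (_ * _)%g.
      have E : (sref i * (sref j * sref i) = tperm (ilo i) (ihi j))%g.
        by rewrite -{1}[sref i]tpermV -/(conjg _ _) tpermJ loj sib sic.
      by rewrite E -{1}[sref j]tpermV -/(conjg _ _) tpermJ sja sjb.
    have rE : wprod r = smul i (smul j (smul i w)) by apply: reduced_wordK.
    have rr : reduced r by apply: reduced_word_reduced.
    have Eu : \prod_(l <- u) T l = \prod_(l <- [:: j, i & r]) T l.
      apply: IH => //; last by rewrite /= rE !smulK.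
      rewrite !reduced_cons rr /= rE smulK /descent !smulV loj.
      rewrite ?(sia, sib, sic, sja, sjb, sjc).
      by lia.
    have Ev : \prod_(l <- v) T l = \prod_(l <- [:: i, j & r]) T l.
      apply: IH => //; last by rewrite /= rE braid !smulK.
      rewrite !reduced_cons rr /= rE braid smulK /descent !smulV loj.
      rewrite ?(sia, sib, sic, sja, sjb, sjc).
      by lia.
    by rewrite Eu Ev !big_cons !mulrA (T_braid ij1).
  have far : (i.+1 < j)%N || (j.+1 < i)%N by lia.
  have far' : (j.+1 < i)%N || (i.+1 < j)%N by lia.
  have [silo sihi sC] := sref_comm far; have [sjlo sjhi _] := sref_comm far'.
  have xE : smul j (smul i w) = smul i (smul j w) by rewrite /smul -!mulgA sC.
  pose r := reduced_word (smul j (smul i w)).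
  have rE : wprod r = smul j (smul i w) by apply: reduced_wordK.
  have rr : reduced r by apply: reduced_word_reduced.
  have Eu : \prod_(l <- u) T l = \prod_(l <- j :: r) T l.
    apply: IH => //; last by rewrite /= rE smulK.
    by rewrite reduced_cons rr rE descent_smul negbK /descent !smulV silo sihi andbT.
  have Ev : \prod_(l <- v) T l = \prod_(l <- i :: r) T l.
    apply: IH => //; last by rewrite /= rE xE smulK.
    rewrite reduced_cons rr rE xE descent_smul negbK /descent !smulV sjlo sjhi.
    by rewrite andbT.
  by rewrite Eu Ev !big_cons !mulrA (T_comm far).
case=> [|i u] [|j v] //= um su rv uv.
- by move: rv; rewrite /reduced /= -uv perm_len1.
- by move: su; rewrite /reduced /= uv perm_len1.
have [ij|ij|ij] := ltngtP i j; first exact: step.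
- apply/esym/step => //; move: (congr1 (@perm_len n) uv).
  have [/eqP/= E1 /eqP/= E2] : reduced (i :: u) /\ reduced (j :: v) by [].
  by rewrite E1 E2 => -[<-].
have {}ij : i = j by apply: val_inj.
rewrite !big_cons ij (IH u v) //.
- by move: su; rewrite reduced_cons => /andP[].
- by move: rv; rewrite reduced_cons => /andP[].
by apply: (can_inj (smulK i)); rewrite {2}ij.
Qed.

End Matsumoto.

End Length.

(** * Exponents of Laurent monomials *)

Section Exponents.
Variable n : nat.
Local Notation exponent := {ffun 'I_n -> int}.
Implicit Types (m : exponent) (w : 'S_n).

Lemma xvar_intmul (j : 'I_n) (c : int) (i : 'I_n) :
  (xvar j *~ c) i = (i == j)%:Z * c.
Proof.
have nE p : (xvar j *+ p) i = (i == j)%:Z * p%:Z.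
  elim: p => [|p IH]; first by rewrite mulr0 ffunE.
  by rewrite mulrS !ffunE IH -[in RHS]add1n PoszD mulrDr mulr1.
by case: c => p; rewrite ?NegzE ?mulrNz ?ffunE -pmulrn nE ?mulrN.
Qed.

(** The unit vectors generate the group of exponents; claims on monomials thus reduce to
    multiplication by X_j and X_j^-1. *)
Lemma exponent_ind (P : exponent -> Prop) :
    P 0 -> (forall m j, P m -> P (m + xvar j)) ->
    (forall m j, P m -> P (m - xvar j)) ->
  forall m, P m.
Proof.
move=> P0 PD PB m.
have Pn j m' p : P m' -> P (m' + xvar j *+ p) /\ P (m' - xvar j *+ p).
  move=> Pm'; elim: p => [|p [IH1 IH2]]; first by rewrite mulr0n subr0 addr0.
  by rewrite mulrSr opprD !addrA; split; [apply: PD|apply: PB].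
have Pz j m' (c : int) : P m' -> P (m' + xvar j *~ c).
  by case: c => p /(Pn j _) H; [case: (H p)|case: (H p.+1)]; rewrite // NegzE mulrNz.
have -> : m = \sum_j xvar j *~ m j.
  apply/ffunP => i; rewrite sum_ffunE (bigD1 i) //= big1 => [|j /negPf ji].
    by rewrite addr0 xvar_intmul eqxx mul1r.
  by rewrite xvar_intmul eq_sym ji mul0r.
elim: (index_enum _) => [|j s IH]; rewrite ?big_nil // big_cons addrC.
exact: Pz.
Qed.

Lemma xpermD w m m' : xperm w (m + m') = xperm w m + xperm w m'.
Proof. by apply/ffunP => j; rewrite !ffunE. Qed.

Lemma xperm0 w : xperm w 0 = 0.
Proof. by apply/ffunP => j; rewrite !ffunE. Qed.

Lemma xpermN w m : xperm w (- m) = - xperm w m.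
Proof. by apply/ffunP => j; rewrite !ffunE. Qed.

Lemma xperm_var w j : xperm w (xvar j) = xvar (w j).
Proof.
by apply/ffunP => i; rewrite !ffunE -[in RHS](permKV w i) (inj_eq perm_inj).
Qed.

End Exponents.

(** * Laurent polynomials and the calculus of Demazure operators *)

Section LaurentFacts.
Variables (k : comNzRingType) (R : algType k) (n : nat).
Local Notation L := (laurent R n).
Local Notation exponent := {ffun 'I_n -> int}.
Implicit Types (f g : L) (m : exponent) (i : 'I_n.-1) (w : 'S_n).

Lemma lmonM (a b : R) m m' :
  lmon (k := k) a m * lmon (k := k) b m' = lmon (a * b) (m + m') :> L.
Proof. exact: lmul_mon. Qed.

Lemma lmon1_comm m f : lmon 1 m * f = f * lmon 1 m.
Proof.
elim/(@laurent_ind _ R): f => [|f g IHf IHg|a m']; first by rewrite mulr0 mul0r.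
- by rewrite mulrDr mulrDl IHf IHg.
- by rewrite !lmonM mul1r mulr1 addrC.
Qed.

Lemma lmonE (a : R) m : lmon a m = lmon a 0 * lmon 1 m :> L.
Proof. by rewrite lmonM mulr1 add0r. Qed.

(** Additivity forces [F 0 m = 0], so all the sums can be taken over one common finite set. This
    serves both [Haff_P] and [diag_perm]. *)
Lemma supp_sumD (W : zmodType) (F : R -> exponent -> W) :
    (forall a b m, F (a + b) m = F a m + F b m) ->
  {morph (fun f : L => \sum_(m <- msupp f) F f@_m m) : f g / f + g}.
Proof.
move=> FD f g /=.
have F0 m : F 0 m = 0 by apply: (addrI (F 0 m)); rewrite -FD !addr0.
have sumw (d : {fset exponent}) (h : L) : (msupp h `<=` d)%fset ->
    \sum_(m <- msupp h) F h@_m m = \sum_(m <- d) F h@_m m.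
  by move=> hd; apply: big_fset_incl => // m _ /mcoeff_outdom ->.
pose d := (msupp f `|` msupp g)%fset.
rewrite !(@sumw d) ?fsubsetUl ?fsubsetUr ?msuppD_le // -big_split.
by apply: eq_bigr => m _; rewrite mcoeffD FD.
Qed.

Lemma supp_sum_mon (W : zmodType) (F : R -> exponent -> W) (a : R) m :
  (forall m, F 0 m = 0) ->
  \sum_(m' <- msupp (lmon a m : L)) F (lmon a m)@_m' m' = F a m.
Proof.
move=> F0; have [->|a0] := eqVneq a 0.
  by rewrite /lmon monalgU0 msupp0 big_seq_fset0 F0.
by rewrite msuppU (negPf a0) big_seq_fset1 mcoeffUU.
Qed.

Lemma lperm0 w : lperm w (0 : L) = 0.
Proof. by rewrite /lperm msupp0 big_seq_fset0. Qed.

Lemma lpermM w f g : lperm w (f * g) = lperm w f * lperm w g.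
Proof.
elim/(@laurent_ind _ R): f => [|f f' IHf IHf'|a m].
- by rewrite mul0r lperm0 mul0r.
- by rewrite mulrDl !lpermD mulrDl IHf IHf'.
elim/(@laurent_ind _ R): g => [|g g' IHg IHg'|b m'].
- by rewrite mulr0 lperm0 mulr0.
- by rewrite mulrDr !lpermD mulrDr IHg IHg'.
by rewrite lmonM !lperm_mon lmonM xpermD.
Qed.

Lemma lperm1 w : lperm w (1 : L) = 1.
Proof. by rewrite [LHS]lperm_mon xperm0. Qed.

Lemma lperm_X w j : lperm w (LX R j) = LX R (w j).
Proof. by rewrite lperm_mon xperm_var. Qed.

Lemma xratio_comm i f : (1 - xratio R i) * f = f * (1 - xratio R i).
Proof. by rewrite mulrBl mulrBr mul1r mulr1 xratioE lmon1_comm. Qed.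

(** [demazure] is a chosen quotient; left regularity of the divisor pins it down, and its values
    below are computed by exhibiting a quotient. *)
Lemma demazure_uniq i f g :
  (1 - xratio R i) * g = f - lperm (sref i) f -> demazure i f = g.
Proof. by move=> fg; apply: (@xratio_regular k R n i); rewrite demazureP fg. Qed.

Lemma demazureD i f g : demazure i (f + g) = demazure i f + demazure i g.
Proof.
apply: demazure_uniq.
apply: etrans (mulrDr _ _ _) _.
apply: etrans (congr2 +%R (demazureP i f) (demazureP i g)) _.
by rewrite lpermD opprD; exact: addrACA.
Qed.

(** A twisted Leibniz rule: the divisor is central, so it can be moved past the twisted factor. *)
Lemma demazureM i f g :
  demazure i (f * g) = demazure i f * g + lperm (sref i) f * demazure i g.
Proof.
apply: demazure_uniq; rewrite mulrDr.
rewrite [(1 - _) * (demazure i f * g)]mulrA demazureP mulrBl.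
rewrite [(1 - _) * (lperm _ f * _)]mulrA xratio_comm.
rewrite -[lperm _ f * _ * _]mulrA demazureP mulrBr.
by rewrite lpermM addrA subrK.
Qed.

Lemma demazure0 i : demazure i (0 : L) = 0.
Proof. by apply: demazure_uniq; rewrite mulr0 lperm0 subrr. Qed.

Lemma demazure_cst i (a : R) f : demazure i (lmon a 0 * f) = lmon a 0 * demazure i f.
Proof.
have -> : demazure i (lmon a 0 * f) =
    demazure i (lmon a 0) * f + lmon a 0 * demazure i f.
  by rewrite demazureM lperm_mon xperm0.
rewrite (_ : demazure i (lmon a 0) = 0) ?mul0r ?add0r //.
by apply: demazure_uniq; rewrite mulr0 lperm_mon xperm0 subrr.
Qed.

Lemma demazure1 i : demazure i (1 : L) = 0.
Proof. by apply: demazure_uniq; rewrite mulr0 lperm1 subrr. Qed.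

Lemma demazure_X i j : j != ilo i -> j != ihi i -> demazure i (LX R j) = 0.
Proof.
move=> jl jh; apply: demazure_uniq.
by rewrite mulr0 lperm_X tpermD 1?eq_sym // subrr.
Qed.

Lemma xratio_X i : xratio R i * LX R (ihi i) = LX R (ilo i).
Proof. by rewrite /xratio /LX /LXV !lmonM !mulr1 subrK. Qed.

Lemma demazure_Xlo i : demazure i (LX R (ilo i)) = - LX R (ihi i).
Proof.
by apply: demazure_uniq; rewrite lperm_X tpermL mulrN mulrBl mul1r xratio_X opprB.
Qed.

Lemma demazure_Xhi i : demazure i (LX R (ihi i)) = LX R (ihi i).
Proof. by apply: demazure_uniq; rewrite lperm_X tpermR mulrBl mul1r xratio_X. Qed.

(** The Leibniz rule turns the left side into f + X_i X_(i+1)^-1 Delta_i(f), and the defining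
    equation of Delta_i rewrites the last term. *)
Lemma demazure_twist i f :
  LXV R (ihi i) * demazure i (LX R (ihi i) * f) = lperm (sref i) f + demazure i f.
Proof.
rewrite demazureM demazure_Xhi lperm_X tpermR mulrDr !mulrA.
have VX : LXV R (ihi i) * LX R (ihi i) = 1 by rewrite lmonM mulr1 addNr.
have VXlo : LXV R (ihi i) * LX R (ilo i) = xratio R i by rewrite lmon1_comm.
have DE : demazure i f = f - lperm (sref i) f + xratio R i * demazure i f.
  by rewrite -demazureP mulrBl mul1r subrK.
by rewrite VX mul1r VXlo [in RHS]DE addrA [lperm _ _ + _]addrC subrK.
Qed.

End LaurentFacts.

(** * Computing in algebras given by generators and relations *)

Section Presented.
Variables (k : comNzRingType) (G : Type) (R : expr k G -> expr k G -> Prop).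

Lemma pclass_rel x y : R x y -> pclass R x = pclass R y.
Proof. by move=> xy; apply/eqP/pclassP/econg_rel. Qed.

Lemma pclass_add x y : pclass R (EAdd x y) = pclass R x + pclass R y.
Proof. by rewrite -pclassD. Qed.

Lemma pclass_mul x y : pclass R (EMul x y) = pclass R x * pclass R y.
Proof. by rewrite -pclassM. Qed.

Lemma pclass_one : pclass R (ECst G 1) = 1.
Proof. by []. Qed.

Lemma pclass_cst c : pclass R (ECst G c) = c *: (1 : presented R).
Proof.
rewrite -pclass_one [RHS]pclassZ; apply/eqP/pclassP.
by rewrite -{1}[c]mulr1; apply: econg_cstM.
Qed.

Lemma presented_ind (P : presented R -> Prop) :
    (forall g, P (pgen R g)) -> (forall c, P (c *: (1 : presented R))) ->
    (forall u v, P u -> P v -> P (u + v)) ->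
    (forall u v, P u -> P v -> P (u * v)) -> forall u, P u.
Proof.
move=> Pg Pc PD PM; apply: pclassW; elim=> [g|c|x Px y Py|x Px y Py].
- exact: Pg.
- by rewrite pclass_cst; apply: Pc.
- by rewrite pclass_add; apply: PD.
- by rewrite pclass_mul; apply: PM.
Qed.

Section Homogeneous.
Variable hg : bool -> G -> Prop.
Local Notation hom := (phomog (R := R) hg).

Lemma phomog0 p : hom p 0.
Proof. by exists (ECst G 0); [apply: ehomog_zero|]. Qed.

Lemma phomog1 : hom false 1.
Proof. by exists (ECst G 1); [apply: ehomog_cst|]. Qed.

Lemma phomogD p u v : hom p u -> hom p v -> hom p (u + v).
Proof.
move=> [x xp <-] [y yp <-].
by exists (EAdd x y); [apply: ehomog_add|rewrite pclass_add].
Qed.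

Lemma phomogM p q u v : hom p u -> hom q v -> hom (p (+) q) (u * v).
Proof.
move=> [x xp <-] [y yp <-].
by exists (EMul x y); [apply: ehomog_mul|rewrite pclass_mul].
Qed.

Lemma phomog_gen p g : hg p g -> hom p (pgen R g).
Proof. by exists (EGen k g); [apply: ehomog_gen|]. Qed.

End Homogeneous.

Section Morphism.
Variables (C : pzRingType) (cst : k -> C) (inc : C -> G).
Hypothesis inc_rel : forall x y, morphism_rel cst inc x y -> R x y.

Lemma pgen_morphD a b : pgen R (inc (a + b)) = pgen R (inc a) + pgen R (inc b).
Proof. by rewrite -pclass_add; apply/pclass_rel/inc_rel; constructor. Qed.

Lemma pgen_morphM a b : pgen R (inc (a * b)) = pgen R (inc a) * pgen R (inc b).
Proof. by rewrite -pclass_mul; apply/pclass_rel/inc_rel; constructor. Qed.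

Lemma pgen_morphC c : pgen R (inc (cst c)) = c *: (1 : presented R).
Proof. by rewrite -pclass_cst; apply/pclass_rel/inc_rel; constructor. Qed.

Lemma pgen_morph0 : pgen R (inc 0) = 0.
Proof. by apply: (addrI (pgen R (inc 0))); rewrite -pgen_morphD !addr0. Qed.

End Morphism.

End Presented.

(** * Superpermutation of tensor factors by s_i *)

Section Superpermutation.
Variables (k : comNzRingType) (A : algType k) (S : superalgebra A).
Variables (B : finType) (bs : homog_basis S B) (n : nat).
Local Notation TA := (tpow bs n).
Implicit Types (w : 'S_n) (i : 'I_n.-1) (x y : TA).

Lemma superpermD w x y : superperm w (x + y) = superperm w x + superperm w y.
Proof. by apply/ffunP => e; rewrite !ffunE /= [X in _ * X]ffunE; exact: mulrDr. Qed.

Lemma superperm0 w : superperm w (0 : TA) = 0.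
Proof. by apply/ffunP => e; rewrite !ffunE /= [X in _ * X]ffunE; exact: mulr0. Qed.

Lemma superperm1 w : superperm w (1 : TA) = 1.
Proof.
rewrite [LHS](@superperm_ptens _ _ _ _ bs n w (fun=> false)) => [|i]; last first.
  exact: homog_one.
by rewrite /psign big1 => [|i _]; rewrite ?scale1r // big1.
Qed.

(** The only inversion of s_i is the pair (i, i+1). *)
Lemma psign_sref i (p : 'I_n -> bool) : psign (sref i) p = p (ilo i) && p (ihi i).
Proof.
have lt1 (a b : 'I_n) :
    (a < b)%N && (sref i b < sref i a)%N = (a == ilo i) && (b == ihi i).
  rewrite /sref; case: tpermP => [->|->|/eqP + /eqP];
    case: tpermP => [->|->|/eqP + /eqP];
    rewrite -!val_eqE /=; lia.
rewrite /psign (bigD1 (ilo i)) //= [X in _ (+) X]big1 => [|a /negPf alo].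
  by rewrite addbF (big_pred1 (ihi i)) // => b; have := lt1 (ilo i) b; rewrite eqxx.
by apply: big_pred0 => b; rewrite lt1 alo.
Qed.

(** The sign is symmetric in the parities at places i and i+1, so it occurs twice and cancels. *)
Lemma superperm_srefK i : involutive (superperm (bs := bs) (sref i)).
Proof.
move=> x; apply/ffunP => e; rewrite ffunE /= [X in _ * X]ffunE /=.
set e' := [ffun j => e _]; have -> : [ffun j => e' (sref i j)] = e.
  by apply/ffunP => j; rewrite !ffunE tpermK.
rewrite !psign_sref /parf !ffunE tpermL tpermR mulrA andbC -signr_addb addbb.
exact: mul1r.
Qed.

End Superpermutation.

(** * Relations of H_n^aff(A, z) and the homomorphism from P_n(A) *)

Section HeckeRelations.
Variables (k : comNzRingType) (A : algType k) (S : superalgebra A).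
Variables (t : trace_form S) (B : finType) (bs : homog_basis S B).
Variables (bd : dual_basis t bs) (n : nat) (z : k).

Local Notation TA := (tpow bs n).
Local Notation Pn := (laurent k^o n).
Local Notation PnA := (laurent TA n).
Local Notation H := (Haff bd n z).
Local Notation P := (Haff_P bd z).
Local Notation T := (Haff_T bd z).
Local Notation Tw := (Haff_Tw bd z).
Local Notation zt i := (z *: tele bd (ilo i) (ihi i) : TA).
Local Notation exponent := {ffun 'I_n -> int}.

Definition Haff_H (h : Hn bd n z) : H := pgen (@Haff_rel _ _ _ _ _ _ bd n z) (inr h).
Definition Haff_A (a : TA) : H := Haff_H (Hn_A bd z a).
Definition Haff_X (p : Pn) : H := pgen (@Haff_rel _ _ _ _ _ _ bd n z) (inl p).

Lemma Haff_HD g h : Haff_H (g + h) = Haff_H g + Haff_H h.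
Proof. exact: (pgen_morphD (@Haff_Hn _ _ _ _ _ _ bd n z)). Qed.

Lemma Haff_HM g h : Haff_H (g * h) = Haff_H g * Haff_H h.
Proof. exact: (pgen_morphM (@Haff_Hn _ _ _ _ _ _ bd n z)). Qed.

Lemma Haff_HC c : Haff_H (c *: (1 : Hn bd n z)) = c *: (1 : H).
Proof. exact: (pgen_morphC (@Haff_Hn _ _ _ _ _ _ bd n z)). Qed.

Lemma Haff_H1 : Haff_H 1 = 1.
Proof. by have := Haff_HC 1; rewrite !scale1r. Qed.

Lemma Haff_XD p q : Haff_X (p + q) = Haff_X p + Haff_X q.
Proof. exact: (pgen_morphD (@Haff_Pn _ _ _ _ _ _ bd n z)). Qed.

Lemma Haff_XM p q : Haff_X (p * q) = Haff_X p * Haff_X q.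
Proof. exact: (pgen_morphM (@Haff_Pn _ _ _ _ _ _ bd n z)). Qed.

Lemma Haff_XC c : Haff_X c%:A = c *: (1 : H).
Proof. exact: (pgen_morphC (@Haff_Pn _ _ _ _ _ _ bd n z)). Qed.

Lemma Haff_X1 : Haff_X 1 = 1.
Proof. by have := Haff_XC 1; rewrite !scale1r. Qed.

Lemma Haff_X0 : Haff_X 0 = 0.
Proof. exact: (pgen_morph0 (@Haff_Pn _ _ _ _ _ _ bd n z)). Qed.

Lemma Haff_AD a b : Haff_A (a + b) = Haff_A a + Haff_A b.
Proof.
by rewrite /Haff_A -Haff_HD /Hn_A (pgen_morphD (@Hn_tpow _ _ _ _ _ _ bd n z)).
Qed.

Lemma Haff_AM a b : Haff_A (a * b) = Haff_A a * Haff_A b.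
Proof.
by rewrite /Haff_A -Haff_HM /Hn_A (pgen_morphM (@Hn_tpow _ _ _ _ _ _ bd n z)).
Qed.

Lemma Haff_AC c : Haff_A c%:A = c *: (1 : H).
Proof.
by rewrite /Haff_A /Hn_A (pgen_morphC (@Hn_tpow _ _ _ _ _ _ bd n z)) Haff_HC.
Qed.

Lemma Haff_A1 : Haff_A 1 = 1.
Proof. by have := Haff_AC 1; rewrite !scale1r. Qed.

Lemma Haff_A0 : Haff_A 0 = 0.
Proof. by apply: (addrI (Haff_A 0)); rewrite -Haff_AD !addr0. Qed.

Lemma Haff_A_X_comm a m :
  Haff_A a * Haff_X (lmon 1 m) = Haff_X (lmon 1 m) * Haff_A a.
Proof.
have Xa j : Haff_A a * Haff_X (LX k^o j) = Haff_X (LX k^o j) * Haff_A a.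
  by have := pclass_rel (Haff_XA bd z j a); rewrite !pclass_mul => ->.
elim/exponent_ind: m => [|m j IH|m j IH].
- by rewrite Haff_X1 mulr1 mul1r.
- have -> : lmon 1 (m + xvar j) = lmon 1 m * LX k^o j :> Pn by rewrite lmonM mulr1.
  by rewrite Haff_XM mulrA IH -mulrA Xa mulrA.
have -> : lmon 1 (m - xvar j) = lmon 1 m * LXV k^o j :> Pn by rewrite lmonM mulr1.
have VX : Haff_X (LXV k^o j) * Haff_X (LX k^o j) = 1.
  by rewrite -Haff_XM lmonM mulr1 addNr Haff_X1.
have XV : Haff_X (LX k^o j) * Haff_X (LXV k^o j) = 1 by rewrite -Haff_XM LXK Haff_X1.
rewrite Haff_XM mulrA IH -!mulrA; congr (_ * _).
(* The defining relation covers X_j alone; for its inverse, a X_j^-1 = X_j^-1 (X_j a) X_j^-1 =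
   X_j^-1 a. *)
by rewrite -[LHS]mul1r -VX -!mulrA [_ * (Haff_A a * _)]mulrA -Xa -!mulrA XV mulr1.
Qed.

Lemma Haff_P_mon a m : P (lmon a m) = Haff_A a * Haff_X (lmon 1 m).
Proof.
apply: (@supp_sum_mon k TA n H (fun a m => Haff_A a * Haff_X (lmon 1 m))) => m'.
by rewrite Haff_A0 mul0r.
Qed.

Lemma Haff_PD (f g : PnA) : P (f + g) = P f + P g.
Proof.
move: f g; apply: (@supp_sumD k TA n H
  (fun a m => Haff_A a * Haff_X (lmon 1 m))) => a b m.
by rewrite Haff_AD mulrDl.
Qed.

Lemma Haff_P0 : P (0 : PnA) = 0.
Proof. by apply: (addrI (P 0)); rewrite -Haff_PD !addr0. Qed.

Lemma Haff_P_cst a : P (lcst a : PnA) = Haff_A a.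
Proof. by rewrite Haff_P_mon Haff_X1 mulr1. Qed.

Lemma Haff_P_X (m : exponent) : P (lmon 1 m) = Haff_X (lmon 1 m).
Proof. by rewrite Haff_P_mon Haff_A1 mul1r. Qed.

Lemma Haff_P1 : P (1 : PnA) = 1.
Proof. by rewrite Haff_P_X Haff_X1. Qed.

Lemma Haff_PM (f g : PnA) : P (f * g) = P f * P g.
Proof.
elim/(@laurent_ind _ TA): f g => [|f f' IHf IHf'|a m] g.
- by rewrite mul0r Haff_P0 mul0r.
- rewrite mulrDl (Haff_PD (f * g)).
  transitivity (P f * P g + P f' * P g); first by congr (_ + _).
  by rewrite -mulrDl (Haff_PD f f').
elim/(@laurent_ind _ TA): g => [|g g' IHg IHg'|b m'].
- by rewrite mulr0 Haff_P0 mulr0.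
- rewrite mulrDr (Haff_PD (_ * g)).
  transitivity (P (lmon a m) * P g + P (lmon a m) * P g'); first by congr (_ + _).
  by rewrite -mulrDr (Haff_PD g g').
rewrite lmonM !Haff_P_mon Haff_AM.
have -> : lmon 1 (m + m') = lmon 1 m * lmon 1 m' :> Pn by rewrite lmonM mulr1.
by rewrite Haff_XM -!mulrA [Haff_A b * (_ * _)]mulrA Haff_A_X_comm !mulrA.
Qed.

Lemma Haff_PN (f : PnA) : P (- f) = - P f.
Proof. by apply: (addrI (P f)); rewrite -Haff_PD !subrr Haff_P0. Qed.

(** Expresses the polynomial generators as values of [Haff_P], whose action on V is prescribed. *)
Lemma Haff_X_sum p :
  Haff_X p = P (\sum_(m <- msupp p) lmon (R := TA) (p@_m *: (1 : TA)) m).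
Proof.
rewrite [in LHS](laurent_sum p).
elim: (enum_fset _) => [|m s IH]; first by rewrite !big_nil Haff_X0 Haff_P0.
rewrite !big_cons Haff_XD Haff_PD IH Haff_P_mon; congr (_ + _).
rewrite Haff_AC -Haff_XC -Haff_XM; congr (Haff_X _).
by rewrite -scalerAl mul1r lmonZ; congr lmon; rewrite /GRing.scale /= mulr1.
Qed.

Lemma Haff_scale1 c : c *: (1 : H) = P (lcst (c *: (1 : TA)) : PnA).
Proof. by rewrite Haff_P_cst Haff_AC. Qed.

Lemma Haff_T_comm (i j : 'I_n.-1) :
  (i.+1 < j)%N || (j.+1 < i)%N -> T i * T j = T j * T i.
Proof.
move=> ij; rewrite -[T i * _]Haff_HM -[T j * _]Haff_HM; congr Haff_H.
by have := pclass_rel (Hn_comm bd z ij); rewrite !pclass_mul.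
Qed.

Lemma Haff_T_braid (i j : 'I_n.-1) :
  j = i.+1 :> nat -> T i * T j * T i = T j * T i * T j.
Proof.
move=> ij; rewrite -[T i * _]Haff_HM -[T j * _]Haff_HM -!Haff_HM; congr Haff_H.
by have := pclass_rel (Hn_braid bd z ij); rewrite !pclass_mul.
Qed.

Lemma Haff_T_quad i : T i * T i = Haff_A (zt i) * T i + 1.
Proof.
rewrite -[LHS]Haff_HM -Haff_H1 -[_ * T i]Haff_HM -Haff_HD; congr Haff_H.
by have := pclass_rel (Hn_quad bd z i); rewrite !(pclass_add, pclass_mul).
Qed.

Lemma Haff_T_A i a : T i * Haff_A a = Haff_A (superperm (sref i) a) * T i.
Proof.
rewrite -[LHS]Haff_HM -[RHS]Haff_HM; congr Haff_H.
by have := pclass_rel (Hn_perm bd z i a); rewrite !pclass_mul.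
Qed.

Lemma Haff_T_X i j : j != ilo i -> j != ihi i ->
  T i * Haff_X (LX k^o j) = Haff_X (LX k^o j) * T i.
Proof.
by move=> jl jh; have := pclass_rel (Haff_TX bd z jl jh); rewrite !pclass_mul.
Qed.

Lemma Haff_T_X_T i : T i * Haff_X (LX k^o (ilo i)) * T i = Haff_X (LX k^o (ihi i)).
Proof. by have := pclass_rel (Haff_TXT bd z i); rewrite !pclass_mul. Qed.

(* [T_i] has a right inverse because [T_i X_i T_i = X_(i+1)] is invertible. *)
Lemma Haff_T_rreg i (x y : H) : x * T i = y * T i -> x = y.
Proof.
have TV : T i * (Haff_X (LX k^o (ilo i)) * T i * Haff_X (LXV k^o (ihi i))) = 1.
  by rewrite !mulrA Haff_T_X_T -Haff_XM LXK Haff_X1.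
by move=> xy; rewrite -[x]mulr1 -TV mulrA xy -mulrA TV mulr1.
Qed.

(* Both sides of [T_i^2 a = a T_i^2] are computed from [T_i^2 = zt T_i + 1]; so the
   teleporter identity need not be checked in the tensor power. *)
Lemma Haff_tele_comm i a :
  Haff_A (superperm (sref i) a) * Haff_A (zt i) = Haff_A (zt i) * Haff_A a.
Proof.
apply: (@Haff_T_rreg i).
have : T i * T i * Haff_A (superperm (sref i) a) =
    Haff_A (superperm (sref i) a) * (T i * T i).
  by rewrite -mulrA Haff_T_A superperm_srefK mulrA Haff_T_A mulrA.
rewrite Haff_T_quad mulrDl mulrDr mul1r mulr1 => /addIr.
by rewrite -mulrA Haff_T_A superperm_srefK !mulrA => ->.
Qed.

Lemma Haff_Tw_homog (w : 'S_n) : Haff_homog false (Haff_Tw bd z w).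
Proof.
rewrite /Haff_Tw; elim/big_ind: _ => [|x y xp yp|i _]; first exact: phomog1.
- exact: phomogM xp yp.
- by do 2 apply: phomog_gen.
Qed.

Lemma Haff_P_homog (p : bool) (f : PnA) :
  (forall m, thomog p f@_m) -> Haff_homog p (P f).
Proof.
move=> fp; rewrite /Haff_P; elim/big_ind: _ => [|x y|m _].
- exact: phomog0.
- exact: phomogD.
rewrite -[p]addbF; apply: phomogM; apply: phomog_gen => //.
by apply: phomog_gen; apply: fp.
Qed.

Lemma V_to_Haff_homog (p : bool) (v : Vmod bs n) :
  Vhomog p v -> Haff_homog p (V_to_Haff bd z v).
Proof.
move=> vp; rewrite /V_to_Haff; elim/big_ind: _ => [|x y|w _].
- exact: phomog0.
- exact: phomogD.
rewrite -[p]addbF; apply: phomogM (Haff_Tw_homog w).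
exact: Haff_P_homog (vp w).
Qed.

End HeckeRelations.

(** * The relation for T f in abstract rings: [sf], [df] and [c] stand for s_i(f), Delta_i(f) and z
    t_(i,i+1) *)

Section Bernstein.
Variables (L H : pzRingType) (P : L -> H) (T : H) (c : L).
Hypotheses (PD : forall f g, P (f + g) = P f + P g)
           (PM : forall f g, P (f * g) = P f * P g) (P1 : P 1 = 1).
Implicit Types f g sf sg df dg : L.

Lemma bernsteinM f g sf sg df dg : c * sf = sf * c ->
    T * P f = P sf * T + P (c * df) -> T * P g = P sg * T + P (c * dg) ->
  T * P (f * g) = P (sf * sg) * T + P (c * (df * g + sf * dg)).
Proof.
move=> csf Tf Tg; rewrite mulrDr [c * (sf * _)]mulrA csf -[sf * c * _]mulrA.
rewrite PD [c * (_ * g)]mulrA (PM (c * df)) (PM sf (c * dg)) !(PM f) (PM sf sg).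
rewrite mulrA Tf mulrDl -[P sf * T * _]mulrA Tg mulrDr !mulrA -!addrA.
by congr (_ + _); rewrite addrC.
Qed.

(** Multiply the relation for [f] by [P sg] on the left and [P g] on the right. The Leibniz
    hypothesis, an instance of Delta_i(1) = 0, gives [c * dg] in terms of [df]. *)
Lemma bernsteinV f g sf sg df dg : f * g = 1 -> sg * sf = 1 -> c * sg = sg * c ->
    df * g + sf * dg = 0 -> T * P f = P sf * T + P (c * df) ->
  T * P g = P sg * T + P (c * dg).
Proof.
move=> fg sgf csg dfg Tf.
have dgE : c * dg = - (sg * (c * df) * g).
  apply/eqP; rewrite -addr_eq0 -[dg in c * dg]mul1r -sgf !mulrA csg -!mulrA -!mulrDr.
  by rewrite addrC dfg !mulr0.
have PN x : P (- x) = - P x.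
  have P0 : P 0 = 0 by apply: (addrI (P 0)); rewrite -PD !addr0.
  by apply: (addrI (P x)); rewrite -PD !subrr.
have -> : P sg * T = P sg * (T * P f) * P g by rewrite -!mulrA -PM fg P1 mulr1.
by rewrite Tf mulrDr mulrDl [P sg * (_ * T)]mulrA -PM sgf P1 mul1r dgE PN !PM addrK.
Qed.

(** Puts in a coefficient [a]: it becomes [sa] in passing [T], and [sa] reverts to [a] in passing
    [c]. *)
Lemma bernstein_coef a sa f sf df :
    P sa * P c = P c * P a -> T * P a = P sa * T ->
    T * P f = P sf * T + P (c * df) ->
  T * P (a * f) = P (sa * sf) * T + P (c * (a * df)).
Proof.
move=> ac Ta Tf; rewrite (PM a f) mulrA Ta -mulrA Tf mulrDr mulrA -(PM sa sf).
by rewrite !PM !mulrA ac.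
Qed.

End Bernstein.

(** The length-decreasing case: [p], [r] are the images of f and s_i(f), [y] that of z t_(i,i+1)
    Delta_i(f), [a] is z t_(i,i+1), [w] and [v] are T_w and T_(s_i w), and [x] is the resulting
    coefficient of T_w. *)
Lemma bernstein_down (H : pzRingType) (T p r x y a v w : H) :
  x = r * a + y -> T * p = r * T + y -> T * w = a * w + v ->
  r * v + x * w = T * (p * w).
Proof.
move=> -> Tp Tw; rewrite mulrA Tp !mulrDl -[r * T * w]mulrA Tw mulrDr -mulrA.
by rewrite addrA [r * v + _]addrC.
Qed.

(* Otherwise failing unifications between Laurent polynomials compute supports. *)
Local Opaque lmul lmon lscale demazure lperm diag_perm.
Local Opaque tele tmul ptens superperm Haff_P.

(** * The relation for T_i f and the products T_i T_w *)

Section Basis.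
Variables (k : comNzRingType) (A : algType k) (S : superalgebra A).
Variables (t : trace_form S) (B : finType) (bs : homog_basis S B).
Variables (bd : dual_basis t bs) (n : nat) (z : k).

Local Notation TA := (tpow bs n).
Local Notation PnA := (laurent TA n).
Local Notation H := (Haff bd n z).
Local Notation P := (Haff_P bd z).
Local Notation T := (Haff_T bd z).
Local Notation Tw := (Haff_Tw bd z).
Local Notation V := (Vmod bs n).
Local Notation phi := (V_to_Haff bd z).
Local Notation zt i := (z *: tele bd (ilo i) (ihi i) : TA).
Local Notation exponent := {ffun 'I_n -> int}.

Let PD := @Haff_PD _ _ _ _ _ _ bd n z.
Let PM := @Haff_PM _ _ _ _ _ _ bd n z.
Let P1 := @Haff_P1 _ _ _ _ _ _ bd n z.

Lemma diag_permD (w : 'S_n) (f g : PnA) :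
  diag_perm w (f + g) = diag_perm w f + diag_perm w g.
Proof.
move: f g; apply: (@supp_sumD k TA n PnA
  (fun a m => lmon (superperm w a) (xperm w m))) => a b m.
by rewrite superpermD lmonD.
Qed.

Lemma diag_perm_mon (w : 'S_n) (a : TA) (m : exponent) :
  diag_perm w (lmon a m : PnA) = lmon (superperm w a) (xperm w m).
Proof.
apply: (@supp_sum_mon k TA n PnA
  (fun a m => lmon (superperm w a) (xperm w m))) => m'.
by rewrite superperm0 lmon0.
Qed.

Lemma diag_perm0 (w : 'S_n) : diag_perm w (0 : PnA) = 0.
Proof. by apply: (addrI (diag_perm w 0)); rewrite -diag_permD !addr0. Qed.

Lemma diag_perm1 (w : 'S_n) : diag_perm w (1 : PnA) = 1.
Proof. by rewrite [LHS]diag_perm_mon superperm1 xperm0. Qed.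

Lemma lmon1D (m m' : exponent) : lmon 1 (m + m') = lmon 1 m * lmon 1 m' :> PnA.
Proof. by rewrite lmonM mulr1. Qed.

(** Uses the X-only action, which is multiplicative by [lpermM] and agrees with the diagonal one on
    monomials with coefficient 1. *)
Let mon_rel i (f : PnA) : Prop :=
  T i * P f = P (lperm (sref i) f) * T i + P (lcst (zt i) * demazure i f).

Let mon_relD i m m' :
  mon_rel i (lmon 1 m) -> mon_rel i (lmon 1 m') -> mon_rel i (lmon 1 (m + m')).
Proof.
rewrite /mon_rel lmon1D lpermM demazureM lperm_mon.
by apply: (bernsteinM PD PM); exact/esym/lmon1_comm.
Qed.

Let mon_relN i m : mon_rel i (lmon 1 m) -> mon_rel i (lmon 1 (- m)).
Proof.
rewrite /mon_rel !lperm_mon.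
apply: (bernsteinV PD PM P1).
- by rewrite -lmon1D subrr.
- by rewrite -lmon1D xpermN addNr.
- exact/esym/lmon1_comm.
- by rewrite -[X in X * demazure _ _]lperm_mon -demazureM -lmon1D subrr demazure1.
Qed.

Let mon_rel0 i : mon_rel i 1.
Proof.
rewrite /mon_rel lperm1 Haff_P1 demazure1 mulr0 Haff_P0.
by rewrite mulr1 mul1r addr0.
Qed.

Let mon_rel_lo i : mon_rel i (LX TA (ilo i)).
Proof.
rewrite /mon_rel lperm_X tpermL demazure_Xlo mulrN Haff_PN.
(* Multiplying by T_i on the right makes T_i X_i T_i = X_(i+1) and the quadratic relation
   applicable. *)
apply: (@Haff_T_rreg _ _ _ _ _ _ bd n z i).
rewrite mulrBl Haff_PM Haff_P_cst !Haff_P_X Haff_T_X_T -mulrA Haff_T_quad.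
by rewrite mulrDr mulr1 mulrA -Haff_A_X_comm addrAC subrr add0r.
Qed.

Let mon_rel_hi i : mon_rel i (LX TA (ihi i)).
Proof.
rewrite /mon_rel lperm_X tpermR demazure_Xhi.
rewrite Haff_PM Haff_P_cst !Haff_P_X -Haff_T_X_T !mulrA Haff_T_quad.
by rewrite mulrDl mulrDl mul1r addrC.
Qed.

Let mon_rel_var i j : mon_rel i (LX TA j).
Proof.
have [->|jl] := eqVneq j (ilo i); first exact: mon_rel_lo.
have [->|jh] := eqVneq j (ihi i); first exact: mon_rel_hi.
rewrite /mon_rel lperm_X tpermD 1?eq_sym // demazure_X //.
by rewrite mulr0 Haff_P0 addr0 !Haff_P_X Haff_T_X.
Qed.

Lemma Haff_T_P_mon i m : mon_rel i (lmon 1 m).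
Proof.
elim/exponent_ind: m => [|m j IH|m j IH]; first exact: mon_rel0.
- exact: mon_relD IH (mon_rel_var i j).
- exact: mon_relD IH (mon_relN (mon_rel_var i j)).
Qed.

Lemma Haff_T_P i (f : PnA) : T i * P f =
  P (diag_perm (sref i) f) * T i + P (lcst (zt i) * demazure i f).
Proof.
elim/(@laurent_ind _ TA): f => [|f g IHf IHg|a m].
- by rewrite diag_perm0 demazure0 mulr0 Haff_P0 mulr0 mul0r addr0.
- rewrite Haff_PD mulrDr IHf IHg diag_permD demazureD mulrDr !Haff_PD mulrDl.
  exact: addrACA.
have -> : diag_perm (sref i) (lmon a m : PnA) =
    lcst (superperm (sref i) a) * lperm (sref i) (lmon 1 m).
  by rewrite diag_perm_mon lmonE lperm_mon.
rewrite (lmonE a m) demazure_cst.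
apply: (bernstein_coef PM); last exact: Haff_T_P_mon.
- by rewrite !Haff_P_cst; apply: Haff_tele_comm.
- by rewrite !Haff_P_cst Haff_T_A.
Qed.

(** Moving the teleporter to the left turns s_i(a) back into a on coefficients, while the X_j stay
    permuted. *)
Lemma Haff_P_tele i (f : PnA) :
  P (diag_perm (sref i) f) * Haff_A bd z (zt i) = P (lcst (zt i) * lperm (sref i) f).
Proof.
elim/(@laurent_ind _ TA): f => [|f g IHf IHg|a m].
- by rewrite diag_perm0 lperm0 mulr0 Haff_P0 mul0r.
- rewrite (diag_permD _ f g) (lpermD _ f g) mulrDr (Haff_PD _ _ (diag_perm _ f)).
  rewrite mulrDl; apply: etrans (f_equal2 (fun x y : H => x + y) IHf IHg) _.
  exact/esym/Haff_PD.
rewrite diag_perm_mon lperm_mon Haff_PM Haff_P_cst !Haff_P_mon -mulrA.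
by rewrite -Haff_A_X_comm mulrA Haff_tele_comm mulrA.
Qed.

Lemma Haff_Tw1 : Tw (1%g : 'S_n) = 1.
Proof.
have : size (reduced_word (1%g : 'S_n)) = 0%N by rewrite size_reduced_word perm_len1.
by move/size0nil => E; rewrite /Haff_Tw E big_nil.
Qed.

Lemma Haff_T_Tw_up i (w : 'S_n) : ~~ descent i w -> T i * Tw w = Tw (smul i w).
Proof.
move=> wi; rewrite -[LHS](big_cons _ _ i (reduced_word w) xpredT T).
apply: (reduced_prod (@Haff_T_comm _ _ _ _ _ _ bd n z)
                     (@Haff_T_braid _ _ _ _ _ _ bd n z)).
- by rewrite reduced_cons reduced_wordK wi reduced_word_reduced.
- exact: reduced_word_reduced.
- by rewrite /= !reduced_wordK.
Qed.

(** Here T_w = T_i T_(s_i w), so the quadratic relation applies. *)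
Lemma Haff_T_Tw_down i (w : 'S_n) : descent i w ->
  T i * Tw w = Haff_A bd z (zt i) * Tw w + Tw (smul i w).
Proof.
move=> wi; have wE : Tw w = T i * Tw (smul i w).
  by rewrite Haff_T_Tw_up ?descent_smul ?negbK // smulK.
by rewrite {1}wE mulrA Haff_T_quad mulrDl mul1r -mulrA -wE.
Qed.

Lemma V_to_HaffD (u v : V) : phi (u + v) = phi u + phi v.
Proof.
rewrite /V_to_Haff -big_split; apply: eq_bigr => w _.
by rewrite ffunE Haff_PD mulrDl.
Qed.

Lemma V_to_Haff0 : phi (0 : V) = 0.
Proof. by apply: (addrI (phi 0)); rewrite -V_to_HaffD !addr0. Qed.

Lemma vtens_ind (Q : V -> Prop) : Q 0 -> (forall u v, Q u -> Q v -> Q (u + v)) ->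
  (forall f w, Q (vtens f w)) -> forall v, Q v.
Proof.
move=> Q0 QD Qt v; have -> : v = \sum_w vtens (v w) w.
  apply/ffunP => w; rewrite sum_ffunE (bigD1 w) //= ffunE eqxx big1 ?addr0 //.
  by move=> w' /negPf ww'; rewrite ffunE eq_sym ww'.
by elim/big_ind: _.
Qed.

(** * Linearity and bijectivity of the map *)

Section Intertwining.
Variable M : left_module H V.
Hypothesis M_P : forall (f g : PnA) (w : 'S_n),
  M (P f) (vtens g w) = vtens (f * g) w.
Hypothesis M_T_up : forall (i : 'I_n.-1) (f : PnA) (w : 'S_n),
  (perm_len w < perm_len (smul i w))%N ->
  M (T i) (vtens f w) = vtens (diag_perm (sref i) f) (smul i w) +
    vtens (z *: (lcst (tele bd (ilo i) (ihi i)) * demazure i f)) w.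
Hypothesis M_T_down : forall (i : 'I_n.-1) (f : PnA) (w : 'S_n),
  (perm_len (smul i w) < perm_len w)%N ->
  M (T i) (vtens f w) = vtens (diag_perm (sref i) f) (smul i w) +
    vtens (z *: (lcst (tele bd (ilo i) (ihi i)) * LXV TA (ihi i) *
                 demazure i (LX TA (ihi i) * f))) w.

Lemma mact0 h : M h 0 = 0.
Proof. by apply: (addrI (M h 0)); rewrite -mactDr !addr0. Qed.

(** Quantified over all [v] for a fixed [h], so that it is stable under products in [h]. *)
Let intertwines (h : H) : Prop := forall v, phi (M h v) = h * phi v.

Let intertwines_vtens (h : H) :
  (forall f w, phi (M h (vtens f w)) = h * phi (vtens f w)) -> intertwines h.
Proof.
move=> hP; elim/vtens_ind => [|u v IHu IHv|f w]; last exact: hP.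
- by rewrite mact0 V_to_Haff0 mulr0.
- by rewrite mactDr !V_to_HaffD IHu IHv mulrDr.
Qed.

Let intertwinesD g h : intertwines g -> intertwines h -> intertwines (g + h).
Proof. by move=> gP hP v; rewrite mactDl V_to_HaffD gP hP mulrDl. Qed.

Let intertwinesM g h : intertwines g -> intertwines h -> intertwines (g * h).
Proof. by move=> gP hP v; rewrite -mactA gP hP mulrA. Qed.

Let intertwines_P f : intertwines (P f).
Proof.
by apply: intertwines_vtens => g w; rewrite M_P !V_to_HaffE Haff_PM mulrA.
Qed.

Let intertwines_T i : intertwines (T i).
Proof.
apply: intertwines_vtens => f w.
have lcstZ : z *: lcst (tele bd (ilo i) (ihi i)) = lcst (zt i).
  by rewrite /lcst lmonZ.
have [wi|wi] := boolP (descent i w).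
  have E : z *: (lcst (tele bd (ilo i) (ihi i)) * LXV TA (ihi i) *
        demazure i (LX TA (ihi i) * f)) =
      lcst (zt i) * lperm (sref i) f + lcst (zt i) * demazure i f.
    rewrite -(mulrA (lcst _)) (demazure_twist i f) scalerAl lcstZ.
    exact: mulrDr.
  rewrite M_T_down ?[X in (_ < X)%N](perm_len_down wi) // E V_to_HaffD !V_to_HaffE.
  apply: (bernstein_down _ (Haff_T_P i f) (Haff_T_Tw_down wi)).
  by rewrite Haff_P_tele; apply: Haff_PD.
rewrite M_T_up ?perm_len_up // V_to_HaffD !V_to_HaffE scalerAl lcstZ.
by rewrite mulrA Haff_T_P mulrDl -mulrA Haff_T_Tw_up.
Qed.

Let intertwines_scale (c : k) : intertwines (c *: (1 : H)).
Proof. by rewrite Haff_scale1; apply: intertwines_P. Qed.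

Lemma V_to_Haff_mact (h : H) (v : V) : phi (M h v) = h * phi v.
Proof.
move: v; rewrite -/(intertwines h).
elim/presented_ind: h => [[p|h]|c|g h|g h]; last first.
- exact: intertwinesM.
- exact: intertwinesD.
- exact: intertwines_scale.
(* Every element of H_n(A, z) is a generator here, so a second induction goes down to A^(tensor n)
   and the T_i. *)
- rewrite -/(Haff_H h); elim/presented_ind: h => [[a|i]|c|g h|g h].
  + by rewrite -/(Hn_A bd z a) -/(Haff_A bd z a) -Haff_P_cst; apply: intertwines_P.
  + exact: intertwines_T.
  + by rewrite Haff_HC; apply: intertwines_scale.
  + by rewrite Haff_HD; apply: intertwinesD.
  + by rewrite Haff_HM; apply: intertwinesM.
- by rewrite -/(Haff_X bd z p) Haff_X_sum; apply: intertwines_P.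
Qed.

(** Reducedness keeps every letter in the length-increasing case, where s_i(1) = 1 and Delta_i(1) =
    0. *)
Lemma mact_reduced (s : seq 'I_n.-1) : reduced s ->
  M (\prod_(i <- s) T i) (vtens (1 : PnA) 1%g) = vtens (1 : PnA) (wprod s).
Proof.
elim: s => [|i s IH]; first by rewrite big_nil mact1.
rewrite reduced_cons => /andP[si rs]; rewrite big_cons -mactA IH //.
rewrite M_T_up ?perm_len_up // diag_perm1 demazure1 mulr0 scaler0.
rewrite [X in _ + X](_ : _ = 0) ?addr0 //; apply/ffunP => w.
by rewrite !ffunE if_same.
Qed.

Lemma V_to_Haff_bij : bijective (phi : V -> H).
Proof.
exists (fun h => M h (vtens (1 : PnA) 1%g)); last first.
  by move=> h; rewrite V_to_Haff_mact V_to_HaffE Haff_P1 Haff_Tw1 !mulr1.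
elim/vtens_ind => [|u v IHu IHv|f w].
- rewrite V_to_Haff0; apply: (addrI (M 0 (vtens (1 : PnA) 1%g))).
  by rewrite -mactDl !addr0.
- by rewrite V_to_HaffD mactDl IHu IHv.
- rewrite V_to_HaffE -mactA mact_reduced ?reduced_word_reduced // reduced_wordK.
  by rewrite M_P mulr1.
Qed.

End Intertwining.

End Basis.

Theorem theorem3p10 (k : comNzRingType) (char_k : 2%N \notin [pchar k])
    (z : k) (A : algType k) (S : superalgebra A) (t : trace_form S)
    (B : finType) (bs : homog_basis S B) (bd : dual_basis t bs)
    (n : nat) (n_gt0 : (0 < n)%N)
    (M : left_module (Haff bd n z) (Vmod bs n))
    (M_P : forall (f g : laurent (tpow bs n) n) (w : 'S_n),
      M (Haff_P bd z f) (vtens g w) = vtens (f * g) w)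
    (M_T_up : forall (i : 'I_n.-1) (f : laurent (tpow bs n) n) (w : 'S_n),
      (perm_len w < perm_len (smul i w))%N ->
      M (Haff_T bd z i) (vtens f w) =
        vtens (diag_perm (sref i) f) (smul i w) +
        vtens (z *: (lcst (tele bd (ilo i) (ihi i)) * demazure i f)) w)
    (M_T_down : forall (i : 'I_n.-1) (f : laurent (tpow bs n) n) (w : 'S_n),
      (perm_len (smul i w) < perm_len w)%N ->
      M (Haff_T bd z i) (vtens f w) =
        vtens (diag_perm (sref i) f) (smul i w) +
        vtens (z *: (lcst (tele bd (ilo i) (ihi i)) * LXV (tpow bs n) (ihi i) *
                     demazure i (LX (tpow bs n) (ihi i) * f))) w) :
  (forall (f : laurent (tpow bs n) n) (w : 'S_n),
     V_to_Haff bd z (vtens f w) = Haff_P bd z f * Haff_Tw bd z w) /\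
  module_iso M (regular_module (Haff bd n z)) (V_to_Haff bd z) /\
  (forall (p : bool) (v : Vmod bs n),
     Vhomog p v -> Haff_homog p (V_to_Haff bd z v)).
Proof.
split; first exact: V_to_HaffE.
split; last exact: V_to_Haff_homog.
split; first exact: V_to_HaffD.
- exact: (V_to_Haff_mact M_P M_T_up M_T_down).
- exact: (V_to_Haff_bij M_P M_T_up M_T_down).
Qed.
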